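(* Let $a,b$ be integers with $1\le b\le a$, let $(G_n)_{n\ge0}$ be given by $G_0=1$, $G_1=a+1$, $G_{n+2}=aG_{n+1}+bG_n$ $(n\ge 0)$, and let $\alpha=\frac{a+\sqrt{a^2+4b}}{2}$, $\kappa=\frac{a+2+\sqrt{a^2+4b}}{2\sqrt{a^2+4b}}$. Let $f:\mathbb N\to\mathbb R$ be a $G$-additive function for which the series $\sum_{n\ge1}D_n$ and $\sum_{n\ge0}\sum_{1\le k\le a}f(kG_n)^2$ both converge, where $$D_n=\alpha\sum_{1\le k<a}f(kG_n)+\sum_{1\le k<b}f(kG_{n-1})+b\,f(aG_n)\qquad(n\ge1)$$ (equivalently, $f$ has a limiting distribution), and let $\Phi$ be the characteristic function of the limiting distribution of $f$. Then for every $t\in\mathbb R$, $$\Phi(t)=\frac1\kappa\lim_{n\to\infty}\alpha^{-n}\begin{pmatrix}1&0\end{pmatrix}A_{n-1}(t)\cdots A_1(t)\binom{H_1(t)}{1}.$$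
   Context: $\mathbb N=\{0,1,2,\dots\}$. Every $n\in\mathbb N$ has a unique (greedy) expansion $n=\sum_{j\ge0}e_j(n)G_j$ with finitely many non-zero digits satisfying $0\le e_j(n)\le a$ and: $e_{j+1}(n)=a$ implies $e_j(n)<b$. A function $f:\mathbb N\to\mathbb R$ is $G$-additive if $f(0)=0$ and $f(n)=\sum_{j\ge0}f(e_j(n)G_j)$ for all $n\ge1$. The function $f$ has a limiting distribution if there is a (probability) distribution function $F$ with $\frac1N\#\{0\le n<N: f(n)\le x\}\to F(x)$ as $N\to\infty$ at every continuity point $x$ of $F$; its characteristic function is $\Phi(t)=\int e^{itx}\,dF(x)$. For $t\in\mathbb R$ put $H_n(t)=\sum_{0\le m<G_n}e^{itf(m)}$, and for $c\in\{a,b\}$ put $\sigma_n(c;t)=\sum_{0\le k<c}e^{itf(kG_n)}$. For $n\ge1$, $$A_n(t)=\begin{pmatrix}\sigma_n(a;t)&e^{itf(aG_n)}\sigma_{n-1}(b;t)\\1&0\end{pmatrix}.$$ The empty product of matrices is the identity. *)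

(* Defs.v *)
From HB Require Import structures.
From mathcomp Require Import all_boot all_order all_algebra.
From mathcomp Require Import all_classical all_reals all_analysis.
From mathcomp Require Import complex.
From mathcomp Require Import zify.

Set Implicit Arguments.
Unset Strict Implicit.
Unset Printing Implicit Defensive.

Import Order.TTheory GRing.Theory Num.Theory.
Import numFieldNormedType.Exports.

Local Open Scope classical_set_scope.
Local Open Scope ring_scope.
Local Open Scope complex_scope.

Section Numeration.
Local Open Scope nat_scope.
Variables a b : nat.

Fixpoint Gseq (n : nat) : nat :=
  match n with
  | 0 => 1
  | 1 => a.+1
  | (m.+1 as n').+1 => a * Gseq n' + b * Gseq m
  end.

(* The digits vanish from index [K] on; they determine [K] only up to
   enlargement, and the number [n] does not depend on that choice. *)
Definition is_expansion (e : nat -> nat) (K n : nat) : Prop :=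
  [/\ forall j, K <= j -> e j = 0,
      n = \sum_(j < K) e j * Gseq j,
      forall j, e j <= a
    & forall j, e j.+1 = a -> e j < b].

(* Existence and uniqueness of the expansion, so that quantifying over all
   expansions of [n] in [G_additive] is the same as using its digits. *)
Lemma GseqSS n : Gseq n.+2 = a * Gseq n.+1 + b * Gseq n.
Proof. by []. Qed.

Lemma G_gt0 n : 1 <= b <= a -> 0 < Gseq n.
Proof.
move=> hab; suff: 0 < Gseq n /\ 0 < Gseq n.+1 by case.
elim: n => [//|n [h0 h1]]; split=> //.
by move: h0 h1; rewrite GseqSS; nia.
Qed.

Lemma G_step n : 1 <= b <= a -> Gseq n.+1 <= a.+1 * Gseq n.
Proof.
case: n => [|n] hab; first by rewrite /= muln1.
have: b * Gseq n <= Gseq n.+1.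
  by case: n => [|n]; [rewrite /=; lia | rewrite GseqSS; have := G_gt0 n hab; nia].
by rewrite GseqSS mulSn; lia.
Qed.

Lemma sumS (e : nat -> nat) k :
  \sum_(j < k.+1) e j * Gseq j = \sum_(j < k) e j * Gseq j + e k * Gseq k.
Proof. exact: big_ord_recr. Qed.

Lemma expansion_lt (e : nat -> nat) k : 1 <= b <= a ->
  (forall j, e j <= a) -> (forall j, e j.+1 = a -> e j < b) ->
  \sum_(j < k) e j * Gseq j < Gseq k.
Proof.
move=> hab hle hlt.
suff: \sum_(j < k) e j * Gseq j < Gseq k /\ \sum_(j < k.+1) e j * Gseq j < Gseq k.+1.
  by case.
elim: k => [|k [h0 h1]].
  split; first by rewrite big_ord0.
  by rewrite sumS big_ord0 add0n muln1 ltnS hle.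
split=> //; rewrite sumS GseqSS.
have := hle k.+1; rewrite leq_eqVlt => /orP[/eqP ea | ea]; last first.
  have := G_gt0 k hab; have := G_gt0 k.+1 hab; nia.
have Gk := G_gt0 k hab.
move: h1; rewrite sumS => h1; have := hlt _ ea.
by move: h1; rewrite ea; nia.
Qed.

Lemma is_expansion_ex n : 1 <= b <= a -> exists e K, is_expansion e K n.
Proof.
move=> hab.
have nG m : m < Gseq m.
  elim: m {n} => [//|[|m] IH]; first by rewrite /=; lia.
  have h1 := G_gt0 m hab; have h2 := G_gt0 m.+1 hab.
  by move: IH h2; rewrite GseqSS; nia.
suff H k m : m < Gseq k -> exists e, is_expansion e k m.
  by have [e he] := H _ _ (nG n); exists e, n.
elim: k m {n} => [|k IH] m hm.
  exists (fun=> 0); split=> //; last by move=> j; lia.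
  by rewrite big_ord0; case: m hm.
have Gk := G_gt0 k hab.
have [e [e0 er ele elt]] := IH (m %% Gseq k) (ltn_pmod _ Gk).
have hq : m %/ Gseq k <= a.
  by rewrite -ltnS ltn_divLR //; apply: (leq_trans hm); exact: G_step.
have dm := divn_eq m (Gseq k).
exists (fun j => if j == k then m %/ Gseq k else e j); split=> [j hj||j|j].
- by rewrite gtn_eqF // e0 // ltnW.
- apply: etrans (esym (sumS (fun j => if j == k then m %/ Gseq k else e j) k)).
  rewrite eqxx {1}dm addnC er; congr (_ + _).
  by apply: eq_bigr => i _; rewrite (ltn_eqF (ltn_ord i)).
- by case: eqP.
- case: (j.+1 =P k) => [jk | _].
    rewrite ltn_eqF -?jk // => qa.
    have Gj := G_gt0 j hab.
    have l1 : e j * Gseq j <= m %% Gseq j.+1.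
      by rewrite jk er -jk sumS leq_addl.
    by move: hm dm; rewrite -jk qa GseqSS; nia.
  by case: (j =P k) => [-> | _ /elt //]; rewrite e0; lia.
Qed.

Lemma is_expansion_uniq n e K e' K' : 1 <= b <= a ->
  is_expansion e K n -> is_expansion e' K' n -> e =1 e'.
Proof.
move=> hab [z s l c] [z' s' l' c'].
have ext (d : nat -> nat) k m : k <= m -> (forall j, k <= j -> d j = 0) ->
    \sum_(j < k) d j * Gseq j = \sum_(j < m) d j * Gseq j.
  move=> /subnK <- hd; elim: (m - k) => [//|p IH].
  by rewrite addSn sumS -IH hd ?leq_addl // mul0n addn0.
suff H k : \sum_(j < k) e j * Gseq j = \sum_(j < k) e' j * Gseq j ->
    forall j, j < k -> e j = e' j.
  move=> j; apply: (H (maxn j.+1 (maxn K K'))); last by rewrite leq_max leqnn.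
  rewrite -(ext e K) -?(ext e' K') -?s -?s' //; first by rewrite !leq_max leqnn !orbT.
  by rewrite !leq_max leqnn !orbT.
elim: k => [//|k IH]; rewrite !sumS => E.
have h := expansion_lt k hab l c; have h' := expansion_lt k hab l' c'.
have ek : e k = e' k.
  have Gk := G_gt0 k hab.
  have := congr1 (divn^~ (Gseq k)) E.
  by rewrite addnC divnMDl // divn_small // addn0 addnC divnMDl // divn_small // addn0.
move=> j; rewrite ltnS leq_eqVlt => /orP[/eqP -> // | jk].
by apply: IH jk; move: E; rewrite ek => /addIn.
Qed.

End Numeration.

(* Complex numbers, packed as a [numFieldType] to get their norm topology. *)
Definition Cplx (R : realType) : numFieldType := R[i].

Section Additive.
Variables (R : realType) (a b : nat) (f : nat -> R).
Local Notation Gseq := (Gseq a b).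

Definition G_additive : Prop :=
  f 0 = 0 /\
  forall (n : nat) (e : nat -> nat) (K : nat), (1 <= n)%N ->
    is_expansion a b e K n -> f n = \sum_(j < K) f (e j * Gseq j)%N.

Definition alpha : R := (a%:R + Num.sqrt (a%:R ^+ 2 + 4 * b%:R)) / 2.

Definition kappa : R :=
  (a%:R + 2 + Num.sqrt (a%:R ^+ 2 + 4 * b%:R)) /
  (2 * Num.sqrt (a%:R ^+ 2 + 4 * b%:R)).

(* Only meaningful for [1 <= n]. *)
Definition Dterm (n : nat) : R :=
  alpha * \sum_(1 <= k < a) f (k * Gseq n)%N
  + \sum_(1 <= k < b) f (k * Gseq n.-1)%N + b%:R * f (a * Gseq n)%N.

(* A distribution function is a nondecreasing right-continuous function with
   limits 0 at -oo and 1 at +oo. *)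
Definition is_limiting_distribution (F : cumulativeBounded (0 : R) (1 : R)) :
    Prop :=
  forall x : R, {for x, continuous F} ->
    (fun N : nat => #|[pred n : 'I_N | f n <= x]|%:R / N%:R : R) @ \oo --> F x.

Definition expi (x : R) : Cplx R := cos x +i* sin x.

Definition Hsum (n : nat) (t : R) : Cplx R := \sum_(m < Gseq n) expi (t * f m).

Definition sigma (c n : nat) (t : R) : Cplx R :=
  \sum_(k < c) expi (t * f (k * Gseq n)%N).

(* Only meaningful for [1 <= n]. *)
Definition Amx (n : nat) (t : R) : 'M[Cplx R]_2 :=
  \matrix_(i < 2, j < 2)
    (nth [::] [:: [:: sigma a n t;
                      expi (t * f (a * Gseq n)%N) * sigma b n.-1 t];
                  [:: 1; 0]] i)`_j.

(* The product A_(n-1)(t) ... A_1(t), with decreasing indices. *)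
Definition Amx_prod (n : nat) (t : R) : 'M[Cplx R]_2 :=
  \prod_(1 <= k < n) Amx (n - k) t.

Definition row10 : 'rV[Cplx R]_2 := \row_(j < 2) [:: 1; 0]`_j.

Definition colH1 (t : R) : 'cV[Cplx R]_2 := \col_(i < 2) [:: Hsum 1 t; 1]`_i.

(* The term whose limit is taken; the matrix product is 1 x 1. *)
Definition Phi_seq (t : R) (n : nat) : Cplx R :=
  (alpha ^- n)%:C * (row10 *m Amx_prod n t *m colH1 t) 0 0.

End Additive.

(* The integral of e^(itx) dF(x), by real and imaginary parts. *)
Definition char_fun (R : realType) (F : cumulativeBounded (0 : R) (1 : R))
    (t : R) : Cplx R :=
  (\int[lebesgue_stieltjes_measure F]_x cos (t * x)) +i*
  (\int[lebesgue_stieltjes_measure F]_x sin (t * x)).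

(* Main.v *)
(** Splitting the integers below [G_(n+2)] by their leading digit shows that [(H_(n+1), H_n)]
    is the image of [(H_n, H_(n-1))] under [A_n], so the matrix product is [H_n] and, since
    [G_n ~ kappa alpha^n], the claim is that the mean of [exp (i t f)] over [0, G_n) tends to
    the characteristic function: this is the Helly-Bray theorem.

    For the existence of the distribution, write [f = f o low_K + g] where [low_K] keeps the
    digits of index below [K].  The distribution of [f o low_K] converges because digit patterns
    have a density.  The tail [g] is small by Chebyshev's inequality: around the exact mean over
    [0, G_n) the variance satisfies the recursion of [G_n] up to squares of digit values and of
    mean increments, hence is bounded by the tail of the second series, while the mean itself is
    controlled by the partial sums of [D_n].  So the empirical distributions are Cauchy in the
    Levy sense, uniformly in [x], and such a sequence has a limiting distribution function. *)

Require Import Defs.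
From HB Require Import structures.
From mathcomp Require Import all_boot all_order all_algebra.
From mathcomp Require Import all_classical all_reals all_analysis.
From mathcomp Require Import measurable_realfun complex.
From mathcomp Require Import zify ring lra.

Set Implicit Arguments.
Unset Strict Implicit.
Unset Printing Implicit Defensive.

Import Order.TTheory GRing.Theory Num.Theory.
Import numFieldNormedType.Exports.

Local Open Scope classical_set_scope.
Local Open Scope ring_scope.
Local Open Scope complex_scope.

(** * Greedy digits *)

Section Digits.
Local Open Scope nat_scope.
Context (a b : nat) (hab : 1 <= b <= a).
Local Notation G := (Gseq a b).

Lemma Gseq_gt0 n : 0 < G n. Proof. exact: G_gt0. Qed.
Hint Resolve Gseq_gt0 : core.

Lemma Gseq_ltS n : G n < G n.+1.
Proof.
case: n => [|n]; first by rewrite /=; lia.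
by rewrite GseqSS; have := Gseq_gt0 n; have := Gseq_gt0 n.+1; nia.
Qed.

Lemma Gseq_leS n : b * G n <= G n.+1.
Proof.
by case: n => [|n]; [rewrite /=; lia | rewrite GseqSS; have := Gseq_gt0 n; nia].
Qed.

Lemma leq_Gseq m n : m <= n -> G m <= G n.
Proof.
by move=> /subnK <-; elim: (n - m) => [//|p IH]; rewrite (leq_trans IH) // ltnW // Gseq_ltS.
Qed.

Lemma ltn_Gseq n : n < G n.
Proof. by elim: n => [//|n IH]; have := Gseq_ltS n; lia. Qed.

Lemma Gseq_bracket N : 0 < N -> exists n, G n <= N < G n.+1.
Proof.
move=> N0; have [] := @ex_minnP (fun n => N < G n); first by exists N; exact: ltn_Gseq.
case=> [|n] hn hmin; first by move: hn; rewrite /=; lia.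
by exists n; rewrite hn leqNgt; apply/andP; split=> //; apply/negP => /hmin; rewrite ltnn.
Qed.

Lemma Gseq_digit_le n k m : k * G n + m < G n.+1 -> k <= a.
Proof. by have := G_step n hab; have := Gseq_gt0 n; nia. Qed.

Lemma big_supp (T : Type) (idx : T) (op : Monoid.law idx) (F : nat -> T) K L :
    (forall j, K <= j -> F j = idx) -> (forall j, L <= j -> F j = idx) ->
  \big[op/idx]_(j < K) F j = \big[op/idx]_(j < L) F j.
Proof.
wlog KL : K L / K <= L => [H hK hL|hK _].
  by have [/H->//|/ltnW/H->] := leqP K L.
rewrite -!(big_mkord xpredT) (@big_cat_nat _ _ _ K 0 L) //= [X in op _ X]big_nat_cond.
by rewrite [X in op _ X]big1 ?Monoid.mulm1 // => i /andP[/andP[/hK]].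
Qed.

(** A non-zero digit at an index j >= n would by itself contribute G_j >= G_n > m. *)
Lemma expansion_supp e K n m : is_expansion a b e K m -> m < G n ->
  forall j, n <= j -> e j = 0.
Proof.
move=> [e0 -> _ _] + j nj; case: (leqP K j) => [/e0 //|jK].
rewrite (bigD1 (Ordinal jK)) //= => h.
have := leq_Gseq nj; case: (e j) h => [//|p]; rewrite mulSn; lia.
Qed.

Lemma expansion_resize e K n m : is_expansion a b e K m -> m < G n ->
  is_expansion a b e n m.
Proof.
move=> he mn; have e0 := expansion_supp he mn; case: he => eK em h1 h2.
split=> //; rewrite [LHS]em; apply: (@big_supp _ 0 addn (fun j => e j * G j)) => j.
  by move=> /eK ->.
by move=> /e0 ->.
Qed.

Lemma expansion_upd e n k m : is_expansion a b e n m -> k * G n + m < G n.+1 ->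
  is_expansion a b (fun j => if j == n then k else e j) n.+1 (k * G n + m).
Proof.
move=> [e0 em h1 h2] km; split=> [j nj||j|j].
- by rewrite gtn_eqF // e0 // ltnW.
- rewrite big_ord_recr /= eqxx addnC em; congr (_ + _).
  by apply: eq_bigr => i _; rewrite ltn_eqF.
- by case: eqP => // _; exact: Gseq_digit_le km.
- case: (j.+1 =P n) => [jn|_].
    subst n; rewrite ltn_eqF // => ka; subst k.
    (* A leading digit a at index n = j + 1 leaves m < b G_j, so the digit at j is below b. *)
    move: km; rewrite GseqSS ltn_add2l em big_ord_recr /=.
    have := Gseq_gt0 j; nia.
  case: (j =P n) => [->|_ /h2 //]; rewrite e0 //; lia.
Qed.

Definition digit (n : nat) : nat -> nat := sval (cid (is_expansion_ex n hab)).

Lemma digit_expansion n K : n < G K -> is_expansion a b (digit n) K n.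
Proof.
by rewrite /digit; case: cid => e /= [L he] /(expansion_resize he).
Qed.

Lemma digit_add n k m j : m < G n -> k * G n + m < G n.+1 ->
  digit (k * G n + m) j = if j == n then k else digit m j.
Proof.
move=> mn km; have h := expansion_upd (digit_expansion mn) km.
exact: (is_expansion_uniq hab (digit_expansion km) h).
Qed.

Definition low_part K n := \sum_(j < K) digit n j * G j.

Lemma low_part_id K n : n < G K -> low_part K n = n.
Proof. by move=> /digit_expansion[_ e _ _]; rewrite /low_part -e. Qed.

Lemma low_part_add K n k m : K <= n -> m < G n -> k * G n + m < G n.+1 ->
  low_part K (k * G n + m) = low_part K m.
Proof.
move=> Kn mn km; apply: eq_bigr => i _; rewrite digit_add // ltn_eqF //.
exact: leq_trans (ltn_ord i) Kn.
Qed.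

Lemma low_part_digit K n k : K <= n -> k * G n < G n.+1 ->
  low_part K (k * G n) = 0.
Proof.
move=> Kn km; have := @low_part_add K n k 0 Kn (Gseq_gt0 n).
by rewrite !addn0 => -> //; exact: low_part_id.
Qed.

Lemma sum_block (V : nmodType) (F : nat -> V) k g :
  (\sum_(0 <= m < k * g) F m = \sum_(0 <= i < k) \sum_(0 <= m < g) F (i * g + m)%N)%R.
Proof.
elim: k => [|k IH]; first by rewrite mul0n !big_geq.
rewrite big_nat_recr //= -IH mulSn addnC (@big_cat_nat _ _ _ (k * g)) ?leq_addr //=.
congr (_ + _)%R; rewrite -{1}[k * g]add0n big_addn addKn.
by apply: eq_bigr => i _; rewrite addnC.
Qed.

(** A leading digit k < a leaves a free remainder below G_(n+1); the leading digit a leaves one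
    below b G_n, which the next digit cuts into b full blocks. *)
Lemma sum_Gseq_split (V : nmodType) (F : nat -> V) n :
  (\sum_(0 <= m < G n.+2) F m =
   \sum_(0 <= k < a) \sum_(0 <= m < G n.+1) F (k * G n.+1 + m)%N +
   \sum_(0 <= k < b) \sum_(0 <= m < G n) F (a * G n.+1 + (k * G n + m))%N)%R.
Proof.
rewrite GseqSS (@big_cat_nat _ _ _ (a * G n.+1)) ?leq_addr //= sum_block; congr (_ + _)%R.
rewrite -{1}[(a * _)%N]add0n big_addn addKn sum_block.
by apply: eq_bigr => i _; apply: eq_bigr => j _; rewrite addnC.
Qed.

(* Unlike [G_additive], this form asks nothing of expansions and is what truncation to the
   digits of high index preserves. *)
Definition greedy_additive (V : nmodType) (f : nat -> V) := (f 0%N = 0 /\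
  forall n k m, (m < G n)%N -> (k * G n + m < G n.+1)%N ->
    f (k * G n + m)%N = f (k * G n)%N + f m)%R.

Lemma G_additive_greedy (R : realType) (f : nat -> R) :
  G_additive a b f -> greedy_additive f.
Proof.
move=> [f0 fadd]; split=> // n k m mn km.
(* [G_additive] gives the digit formula for positive arguments only, so zero summands are settled
   first by [f0]. *)
case: (posnP (k * G n)) => [->|kn0]; first by rewrite add0n f0 add0r.
case: (posnP m) => [->|m0]; first by rewrite addn0 f0 addr0.
have em := digit_expansion mn.
rewrite (fadd _ _ _ _ (expansion_upd em km)) ?addn_gt0 ?kn0 // (fadd _ _ _ m0 em).
rewrite big_ord_recr /= eqxx addrC; congr (_ + _)%R.
by apply: eq_bigr => i _; rewrite ltn_eqF.
Qed.

Lemma greedy_low_sub (V : zmodType) (f : nat -> V) K : greedy_additive f ->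
  greedy_additive (fun m => f m - f (low_part K m))%R.
Proof.
move=> [f0 fadd]; split=> [|n k m mn km].
  by rewrite low_part_id ?subrr.
have km' : k * G n < G n.+1 by lia.
(* If K <= n, the low part ignores the digit at n; otherwise all three numbers are below G_K and the
   difference vanishes. *)
have [Kn|nK] := leqP K n.
  by rewrite low_part_add // fadd // low_part_digit // f0 subr0 addrA.
have GK := leq_Gseq nK; rewrite !low_part_id ?subrr ?addr0 //.
- by apply: leq_trans mn _; apply: leq_Gseq; lia.
- exact: leq_trans km' GK.
- exact: leq_trans km GK.
Qed.

Lemma greedy_low_digit (V : zmodType) (f : nat -> V) K n k : greedy_additive f ->
  (k * G n < G n.+1) ->
  (f (k * G n)%N - f (low_part K (k * G n)) = if (K <= n)%N then f (k * G n)%N else 0)%R.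
Proof.
move=> [f0 fadd] km; case: leqP => [Kn|nK]; last first.
  by rewrite low_part_id ?subrr //; exact: leq_trans km (leq_Gseq nK).
by rewrite low_part_digit // f0 subr0.
Qed.

(** The free [F] makes one splitting serve the mean, the squared deviations and the exponential
    sums. *)
Lemma greedy_sum_split (V : nmodType) (W : nmodType) (f : nat -> W) (F : W -> V) n :
    greedy_additive f ->
  (\sum_(0 <= m < G n.+2) F (f m) =
   \sum_(0 <= k < a) \sum_(0 <= m < G n.+1) F (f (k * G n.+1)%N + f m) +
   \sum_(0 <= k < b) \sum_(0 <= m < G n)
      F (f (a * G n.+1)%N + f (k * G n)%N + f m))%R.
Proof.
move=> [f0 fadd]; rewrite sum_Gseq_split; congr (_ + _)%R.
  apply: eq_big_nat => k /andP[_ ka]; apply: eq_big_nat => m /andP[_ mn].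
  rewrite fadd // GseqSS; have := Gseq_gt0 n; nia.
apply: eq_big_nat => k /andP[_ kb]; apply: eq_big_nat => m /andP[_ mn].
have km : k * G n + m < G n.+1 by have := Gseq_leS n; nia.
by rewrite fadd // ?GseqSS; [rewrite fadd // addrA | nia].
Qed.

End Digits.

Lemma sum_const_nat0 (R : pzRingType) (x : R) n : \sum_(0 <= k < n) x = n%:R * x.
Proof. by rewrite sumr_const_nat subn0 mulr_natl. Qed.

(** * Mean and variance over [0, G_n) *)

Lemma sqr_sum_norm_le (R : realDomainType) (y : nat -> R) p :
  (\sum_(0 <= i < p) `|y i|) ^+ 2 <= p%:R * \sum_(0 <= i < p) y i ^+ 2.
Proof.
elim: p => [|p IH]; first by rewrite !big_geq // expr0n mulr0.
rewrite !big_nat_recr //= -natr1.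
set s := \sum_(0 <= i < p) _ in IH *; set q := \sum_(0 <= i < p) _ in IH *.
have q0 : 0 <= q by apply: sumr_ge0 => i _; exact: sqr_ge0.
have s0 : 0 <= s by apply: sumr_ge0.
have z0 := normr_ge0 (y p); rewrite -(real_normK (num_real (y p))).
have p0 : 0 <= p%:R :> R by [].
move: p%:R `|y p| p0 z0 IH => P z P0 z0 IH.
(* Squared, this is 4 s^2 z^2 <= 4 P q z^2 <= (q + P z^2)^2. *)
have : 2 * (s * z) <= q + P * z ^+ 2.
  rewrite -ler_sqr ?nnegrE ?addr_ge0 ?mulr_ge0 ?sqr_ge0 //.
  have := sqr_ge0 (q - P * z ^+ 2); have := ler_wpM2r (sqr_ge0 z) IH.
  rewrite sqrrB sqrrD !exprMn; lra.
lra.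
Qed.

Section Variance.
Context (R : realType) (a b : nat) (hab : (1 <= b <= a)%N).
Local Notation G := (Gseq a b).
Context (g : nat -> R) (hg : greedy_additive a b g).

Definition digit_norm n : R := \sum_(1 <= k < a.+1) `|g (k * G n)%N|.
Definition total n : R := \sum_(0 <= m < G n) g m.
Definition mean n : R := total n / (G n)%:R.
Definition mean_step n : R := mean n.+1 - mean n.
(** G_n times the variance of [g] on [0, G_n). *)
Definition sqdev n : R := \sum_(0 <= m < G n) (g m - mean n) ^+ 2.

Lemma Gseq_gt0R n : 0 < (G n)%:R :> R.
Proof. by rewrite ltr0n Gseq_gt0. Qed.
Hint Resolve Gseq_gt0R : core.

Lemma digit_norm_ge0 n : 0 <= digit_norm n.
Proof. by apply: sumr_ge0 => k _. Qed.

Lemma digit_le_norm n k : (k <= a)%N -> `|g (k * G n)%N| <= digit_norm n.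
Proof.
case: k => [|k] ka; first by rewrite mul0n hg.1 normr0 digit_norm_ge0.
rewrite /digit_norm (bigD1_seq k.+1) ?iota_uniq ?mem_index_iota //=.
by rewrite lerDl sumr_ge0.
Qed.

Lemma digit_sum_le n c : (c <= a.+1)%N ->
  `|\sum_(0 <= k < c) g (k * G n)%N| <= digit_norm n.
Proof.
move=> ca; apply: (le_trans (ler_norm_sum _ _ _)).
case: c ca => [|c] ca; first by rewrite big_geq // digit_norm_ge0.
rewrite big_nat_recl // mul0n hg.1 normr0 add0r.
rewrite /digit_norm big_add1 /= [leRHS](@big_cat_nat _ _ _ c) //=.
by rewrite lerDl sumr_ge0.
Qed.

Lemma digit_norm_sqr n :
  digit_norm n ^+ 2 <= a%:R * \sum_(1 <= k < a.+1) g (k * G n)%N ^+ 2.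
Proof.
by rewrite /digit_norm big_add1 [X in _ <= _ * X]big_add1; exact: sqr_sum_norm_le.
Qed.

Lemma total_rec n : total n.+2 =
  a%:R * total n.+1 + b%:R * total n
  + (G n.+1)%:R * \sum_(0 <= k < a) g (k * G n.+1)%N
  + (G n)%:R * (b%:R * g (a * G n.+1)%N + \sum_(0 <= k < b) g (k * G n)%N).
Proof.
rewrite [LHS](greedy_sum_split hab (fun x => x) n hg).
have E p x : \sum_(0 <= m < G p) (x + g m) = (G p)%:R * x + total p.
  by rewrite big_split /= sumr_const_nat subn0 mulr_natl.
rewrite (eq_bigr _ (fun k _ => E _ _)) (eq_bigr _ (fun k _ => E _ _)).
rewrite !big_split /= !sum_const_nat0 -!mulr_sumr big_split /= sum_const_nat0; ring.
Qed.

Lemma totalE n : total n = (G n)%:R * mean n.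
Proof. by rewrite /mean mulrC divfK // gt_eqF. Qed.

Lemma GseqSSR n : (G n.+2)%:R = a%:R * (G n.+1)%:R + b%:R * (G n)%:R :> R.
Proof. by rewrite GseqSS natrD !natrM. Qed.

Lemma Gseq_leR m n : (m <= n)%N -> (G m)%:R <= (G n)%:R :> R.
Proof. by move=> mn; rewrite ler_nat leq_Gseq. Qed.

(* Multiplying by [G_(n+2)] keeps the recursion exact; the feedback coefficient
   [b G_n / G_(n+2)] is at most 1/2. *)
Lemma mean_step_rec n : (G n.+2)%:R * mean_step n.+1 =
  - (b%:R * (G n)%:R * mean_step n)
  + (G n.+1)%:R * \sum_(0 <= k < a) g (k * G n.+1)%N
  + (G n)%:R * (b%:R * g (a * G n.+1)%N + \sum_(0 <= k < b) g (k * G n)%N).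
Proof.
have := total_rec n; rewrite !totalE => e.
by rewrite /mean_step mulrBr e GseqSSR; ring.
Qed.

Lemma mean_step_le n :
  `|mean_step n.+1| <= `|mean_step n| / 2
     + a.+1%:R * (digit_norm n.+1 + digit_norm n).
Proof.
have G2 := Gseq_gt0R n.+2.
rewrite -(ler_pM2l G2) -{1}[(G n.+2)%:R]gtr0_norm // -normrM mean_step_rec.
have b0 : 0 <= b%:R :> R by [].
have ba : b%:R <= a%:R :> R by rewrite ler_nat; case/andP: hab.
have x0 := digit_norm_ge0 n; have x1 := digit_norm_ge0 n.+1.
have g0 := Gseq_gt0R n; have g1 := Gseq_gt0R n.+1.
have g01 := Gseq_leR (leqnSn n); have g12 := Gseq_leR (leqnSn n.+1).
have sa := @digit_sum_le n.+1 a (leqnSn a).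
have sb : `|\sum_(0 <= k < b) g (k * G n)%N| <= digit_norm n.
  by apply: digit_sum_le; case/andP: hab => _ /leqW.
have ga := @digit_le_norm n.+1 a (leqnn a).
(* From b <= a and G_n <= G_(n+1); this is the source of the factor 1/2. *)
have bG : b%:R * (G n)%:R * 2 <= (G n.+2)%:R :> R by rewrite GseqSSR; nra.
apply: (le_trans (ler_normD _ _)).
have -> : a.+1%:R = a%:R + 1 :> R by rewrite natr1.
move: (digit_norm n) (digit_norm n.+1) x0 x1 sa sb ga => x y x0 x1 sa sb ga.
have u1 : `|(G n.+1)%:R * \sum_(0 <= k < a) g (k * G n.+1)%N| <= (G n.+2)%:R * y.
  by rewrite normrM (gtr0_norm g1) ler_pM // ltW.
have u2 : `|(G n)%:R * (b%:R * g (a * G n.+1)%N + \sum_(0 <= k < b) g (k * G n)%N)|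
    <= (G n.+2)%:R * (a%:R * y + x).
  rewrite normrM (gtr0_norm g0).
  apply: ler_pM => //; first exact: le_trans g01 g12.
  apply: le_trans (ler_normD _ _) _; rewrite normrM ger0_norm // lerD //.
  by rewrite ler_pM.
have u3 : `|- (b%:R * (G n)%:R * mean_step n)| <= (G n.+2)%:R * (`|mean_step n| / 2).
  rewrite normrN normrM ger0_norm ?mulr_ge0 //.
  rewrite [leRHS](_ : _ = (G n.+2)%:R / 2 * `|mean_step n|); last by ring.
  by rewrite ler_wpM2r //; lra.
apply: le_trans (lerD (ler_normD _ _) (lexx _)) _.
apply: le_trans (lerD (lerD u3 u1) u2) _.
have := mulr_ge0 (ltW G2) x0; have := mulr_ge0 (mulr_ge0 (ltW G2) x0) (ler0n R a); lra.
Qed.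

(** Squaring [mean_step_le] gives 2 p^2 <= q^2 + 8 (a+1)^2 (y^2 + x^2) for consecutive steps q, p.
    The extra last square on the left supplies the q^2 that the next induction step spends. *)
Lemma mean_step_sqr_sum n : mean_step 0 = 0 ->
  \sum_(0 <= j < n.+1) mean_step j ^+ 2 + mean_step n ^+ 2 <=
  8 * a.+1%:R ^+ 2 * \sum_(0 <= j < n) (digit_norm j.+1 ^+ 2 + digit_norm j ^+ 2).
Proof.
move=> d0; elim: n => [|n IH].
  by rewrite big_nat1 big_geq // d0 expr0n addr0 mulr0.
rewrite big_nat_recr //= [X in _ <= _ * X]big_nat_recr //= [leRHS]mulrDr.
have := mean_step_le n; set X := 8 * _ * \sum_(0 <= j < n) _ in IH *.
set S := \sum_(0 <= j < n.+1) _ in IH *.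
rewrite -(real_normK (num_real (mean_step n.+1))).
rewrite -(real_normK (num_real (mean_step n))) in IH.
have := normr_ge0 (mean_step n); have := normr_ge0 (mean_step n.+1).
have := digit_norm_ge0 n; have := digit_norm_ge0 n.+1.
have : 0 <= a.+1%:R :> R by [].
move: (a.+1%:R) (digit_norm n) (digit_norm n.+1) (`|_|) (`|_|) IH => A x y p q IH A0 y0 x0 p0 q0 pq.
have : p ^+ 2 <= 2 * (q / 2) ^+ 2 + 2 * (A * (y + x)) ^+ 2.
  have : p ^+ 2 <= (q / 2 + A * (y + x)) ^+ 2.
    by rewrite ler_sqr // nnegrE ?addr_ge0 ?mulr_ge0 ?addr_ge0 // divr_ge0.
  have := sqr_ge0 (q / 2 - A * (y + x)); rewrite sqrrB sqrrD; lra.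
have : 2 * (A * (y + x)) ^+ 2 <= 4 * A ^+ 2 * (y ^+ 2 + x ^+ 2).
  have := mulr_ge0 (sqr_ge0 A) (sqr_ge0 (y - x)); rewrite exprMn !sqrrD !sqrrN; lra.
rewrite -/S; lra.
Qed.

(** Parallel-axis identity: deviations from the mean sum to zero, which kills the linear term. *)
Lemma sum_sqr_shift n (d : R) :
  \sum_(0 <= m < G n) (g m - mean n + d) ^+ 2 = sqdev n + (G n)%:R * d ^+ 2.
Proof.
have E m : (g m - mean n + d) ^+ 2 =
  (g m - mean n) ^+ 2 + (2 * d * (g m - mean n) + d ^+ 2) by ring.
rewrite (eq_bigr _ (fun m _ => E m)) !big_split /= -mulr_sumr sumrB.
by rewrite !sum_const_nat0 -/(total n) totalE subrr mulr0 add0r.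
Qed.

(* No cross terms: deviations are taken from the exact mean of each block. *)
Lemma sqdev_rec n :
  sqdev n.+2 = a%:R * sqdev n.+1 + b%:R * sqdev n
  + (G n.+1)%:R * \sum_(0 <= k < a) (g (k * G n.+1)%N - mean_step n.+1) ^+ 2
  + (G n)%:R * \sum_(0 <= k < b)
      (g (a * G n.+1)%N + g (k * G n)%N - mean_step n.+1 - mean_step n) ^+ 2.
Proof.
rewrite /sqdev (greedy_sum_split hab (fun x => (x - mean n.+2) ^+ 2) n hg).
rewrite -!/(sqdev _).
have E1 k : \sum_(0 <= m < G n.+1) (g (k * G n.+1)%N + g m - mean n.+2) ^+ 2 =
    sqdev n.+1 + (G n.+1)%:R * (g (k * G n.+1)%N - mean_step n.+1) ^+ 2.
  rewrite -sum_sqr_shift; apply: eq_bigr => m _.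
  by rewrite /mean_step; congr (_ ^+ 2); ring.
have E2 k : \sum_(0 <= m < G n)
      (g (a * G n.+1)%N + g (k * G n)%N + g m - mean n.+2) ^+ 2 =
    sqdev n + (G n)%:R * (g (a * G n.+1)%N + g (k * G n)%N - mean_step n.+1 - mean_step n) ^+ 2.
  rewrite -sum_sqr_shift; apply: eq_bigr => m _.
  by rewrite /mean_step; congr (_ ^+ 2); ring.
rewrite (eq_bigr _ (fun k _ => E1 k)) (eq_bigr _ (fun k _ => E2 k)).
rewrite !big_split /= !sum_const_nat0 -!mulr_sumr; ring.
Qed.

(** A square of four terms is at most four times the sum of their squares, and the block weights add
    up to a G_(n+1) + b G_n = G_(n+2). *)
Lemma sqdev_step n :
  sqdev n.+2 <= a%:R * sqdev n.+1 + b%:R * sqdev n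
    + 4 * (digit_norm n.+1 ^+ 2 + digit_norm n ^+ 2
           + mean_step n.+1 ^+ 2 + mean_step n ^+ 2) * (G n.+2)%:R.
Proof.
rewrite sqdev_rec -addrA lerD2l; set W := _ + _ + _ + _.
have g0 := Gseq_gt0R n; have g1 := Gseq_gt0R n.+1.
have sq4 (p q r s x y : R) : `|p| <= x -> `|q| <= y ->
    (p + q - r - s) ^+ 2 <= 4 * (x ^+ 2 + y ^+ 2 + r ^+ 2 + s ^+ 2).
  move=> px qy.
  have : p ^+ 2 <= x ^+ 2.
    by rewrite -(real_normK (num_real p)) ler_sqr // nnegrE // (le_trans _ px).
  have : q ^+ 2 <= y ^+ 2.
    by rewrite -(real_normK (num_real q)) ler_sqr // nnegrE // (le_trans _ qy).
  have := sqr_ge0 (p - q); have := sqr_ge0 (p + r); have := sqr_ge0 (p + s).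
  have := sqr_ge0 (q + r); have := sqr_ge0 (q + s); have := sqr_ge0 (r - s).
  by rewrite !expr2; lra.
have S1 : \sum_(0 <= k < a) (g (k * G n.+1)%N - mean_step n.+1) ^+ 2 <= a%:R * (4 * W).
  rewrite -[a in a%:R]subn0 mulr_natl -sumr_const_nat; apply: ler_sum_nat => k /andP[_ ka].
  have := @sq4 (g (k * G n.+1)%N) 0 (mean_step n.+1) 0 (digit_norm n.+1) 0.
  rewrite normr0 addr0 subr0 => /(_ (digit_le_norm _ (ltnW ka)) (lexx _)) /le_trans; apply.
  by rewrite /W; have := sqr_ge0 (digit_norm n); have := sqr_ge0 (mean_step n); lra.
have S2 : \sum_(0 <= k < b)
   (g (a * G n.+1)%N + g (k * G n)%N - mean_step n.+1 - mean_step n) ^+ 2 <= b%:R * (4 * W).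
  rewrite -[b in b%:R]subn0 mulr_natl -sumr_const_nat; apply: ler_sum_nat => k /andP[_ kb].
  apply: sq4; first exact: digit_le_norm.
  by apply: digit_le_norm; case/andP: hab => _; apply: leq_trans (ltnW kb).
apply: le_trans (lerD (ler_wpM2l (ltW g1) S1) (ler_wpM2l (ltW g0) S2)) _.
by rewrite GseqSSR le_eqVlt; apply/orP; left; apply/eqP; ring.
Qed.

Lemma sqdev_bound E : (forall m, (m < G 1)%N -> g m = 0) ->
    (forall n, \sum_(0 <= j < n) digit_norm j ^+ 2 <= E) ->
  forall n, sqdev n <= 8 * (1 + 16 * a.+1%:R ^+ 2) * E * (G n)%:R.
Proof.
move=> g0 hE.
have total0 n : (n <= 1)%N -> total n = 0.
  move=> n1; rewrite /total big_nat big1 // => m /andP[_ mn].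
  by rewrite g0 // (leq_trans mn) // leq_Gseq.
have mean0 n : (n <= 1)%N -> mean n = 0 by move=> n1; rewrite /mean total0 // mul0r.
have sq0 n : (n <= 1)%N -> sqdev n = 0.
  move=> n1; rewrite /sqdev big_nat big1 // => m /andP[_ mn].
  by rewrite g0 ?mean0 ?subrr ?expr0n // (leq_trans mn) // leq_Gseq.
pose W n := digit_norm n.+1 ^+ 2 + digit_norm n ^+ 2
           + mean_step n.+1 ^+ 2 + mean_step n ^+ 2.
(* G solves the homogeneous recursion, so B_n G_n dominates [sqdev] once B absorbs the source term 4
   W_n at each step. Vanishing of [g] below G_1 starts the induction. *)
pose B n := 4 * \sum_(0 <= j < n) W j.
have W0 n : 0 <= W n by rewrite !addr_ge0 // sqr_ge0.
have BS n : B n <= B n.+1 by rewrite /B big_nat_recr //= mulrDr lerDl mulr_ge0.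
have B0 n : 0 <= B n by rewrite mulr_ge0 // sumr_ge0.
have Bsq n : sqdev n.+1 <= B n * (G n.+1)%:R /\ sqdev n <= B n * (G n)%:R.
  elim: n => [|n [IH1 IH0]]; first by rewrite !sq0 //; split; rewrite mulr_ge0.
  split; last by exact: le_trans IH1 (ler_wpM2r (ler0n _ _) (BS n)).
  apply: le_trans (sqdev_step n) _; rewrite -/(W n).
  apply: le_trans (lerD (lerD (ler_wpM2l _ IH1) (ler_wpM2l _ IH0)) (lexx _)) _ => //.
  have -> : B n.+1 = B n + 4 * W n by rewrite /B big_nat_recr //= mulrDr.
  rewrite GseqSSR.
  by rewrite le_eqVlt; apply/orP; left; apply/eqP; ring.
move=> n; apply: le_trans (Bsq n).2 _; apply: ler_wpM2r => //.
have shift n' : \sum_(0 <= j < n') (digit_norm j.+1 ^+ 2 + digit_norm j ^+ 2) <= 2 * E.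
  rewrite big_split /=.
  have : \sum_(0 <= j < n') digit_norm j.+1 ^+ 2 <= \sum_(0 <= j < n'.+1) digit_norm j ^+ 2.
    by rewrite [leRHS]big_nat_recl // lerDr sqr_ge0.
  by have := hE n'; have := hE n'.+1; lra.
have d0 : mean_step 0 = 0 by rewrite /mean_step !mean0 // subrr.
have st : \sum_(0 <= j < n.+1) mean_step j ^+ 2 <= 16 * a.+1%:R ^+ 2 * E.
  have := mean_step_sqr_sum n d0; have := sqr_ge0 (mean_step n).
  have : 8 * a.+1%:R ^+ 2 * \sum_(0 <= j < n) (digit_norm j.+1 ^+ 2 + digit_norm j ^+ 2)
      <= 8 * a.+1%:R ^+ 2 * (2 * E) :> R by rewrite ler_wpM2l // mulr_ge0 ?sqr_ge0.
  lra.
have st1 : \sum_(0 <= j < n) mean_step j.+1 ^+ 2 <= \sum_(0 <= j < n.+1) mean_step j ^+ 2.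
  by rewrite [leRHS]big_nat_recl // lerDr sqr_ge0.
have st0 : \sum_(0 <= j < n) mean_step j ^+ 2 <= \sum_(0 <= j < n.+1) mean_step j ^+ 2.
  by rewrite [leRHS]big_nat_recr //= lerDl sqr_ge0.
(* The digit norms contribute 2 E and each of the two sums of mean steps 16 (a+1)^2 E, all
   multiplied by 4. *)
rewrite /B /W big_split /= big_split /=; have := shift n; lra.
Qed.

End Variance.

(** * Growth of G and control of the mean *)

Section Growth.
Context (R : realType) (a b : nat) (hab : (1 <= b <= a)%N).
Local Notation G := (Gseq a b).
Local Notation alpha := (alpha R a b).
Local Notation kappa := (kappa R a b).

Lemma sqrt_disc_gt : a%:R < Num.sqrt (a%:R ^+ 2 + 4 * b%:R) :> R.
Proof.
have b0 : 0 < b%:R :> R by rewrite ltr0n; case/andP: hab.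
rewrite -ltr_sqr ?nnegrE ?sqrtr_ge0 // sqr_sqrtr ?addr_ge0 ?sqr_ge0 ?mulr_ge0 //.
by rewrite ltrDl mulr_gt0.
Qed.

Lemma sqrt_disc_gt0 : 0 < Num.sqrt (a%:R ^+ 2 + 4 * b%:R) :> R.
Proof. by apply: le_lt_trans sqrt_disc_gt. Qed.

Lemma alpha_sqr : alpha ^+ 2 = a%:R * alpha + b%:R.
Proof.
rewrite /alpha; set s := Num.sqrt _.
have : s ^+ 2 = a%:R ^+ 2 + 4 * b%:R by rewrite sqr_sqrtr // addr_ge0 ?sqr_ge0 ?mulr_ge0.
by move: s => s e; rewrite expr_div_n sqrrD e; field.
Qed.

Lemma alpha_gt : a%:R < alpha.
Proof. by have := sqrt_disc_gt; rewrite /alpha; lra. Qed.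

Lemma alpha_gt1 : 1 < alpha.
Proof.
apply: le_lt_trans alpha_gt; rewrite ler1n.
by case/andP: hab => b1; apply: leq_trans b1.
Qed.

Lemma alpha_gt0 : 0 < alpha.
Proof. by apply: lt_trans alpha_gt1. Qed.

Lemma kappa_gt0 : 0 < kappa.
Proof.
have s0 := sqrt_disc_gt0; by rewrite /kappa divr_gt0 ?mulr_gt0 // addr_gt0 // ltr_wpDl.
Qed.

(** alpha^2 = a alpha + b >= 2 b. The ratio is the feedback coefficient in [mean_bound]. *)
Lemma alpha_theta_le : b%:R / alpha ^+ 2 <= 1 / 2.
Proof.
have A := alpha_gt; have A0 := alpha_gt0.
have ba : b%:R <= a%:R :> R by rewrite ler_nat; case/andP: hab.
have b1 : 1 <= b%:R :> R by rewrite ler1n; case/andP: hab.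
rewrite ler_pdivrMr ?exprn_gt0 // alpha_sqr; nra.
Qed.

(** a - alpha is the conjugate root of x^2 = a x + b; its modulus is b / alpha, and b <= a <
    alpha. *)
Lemma alpha_conj_norm : `|a%:R - alpha| < 1.
Proof.
have A := alpha_gt; have A0 := alpha_gt0; have e := alpha_sqr.
have ba : b%:R <= a%:R :> R by rewrite ler_nat; case/andP: hab.
rewrite ltr0_norm; last by lra.
rewrite -(ltr_pM2r A0); nra.
Qed.

Lemma Gseq_binet n :
  (G n)%:R = kappa * alpha ^+ n + (1 - kappa) * (a%:R - alpha) ^+ n :> R.
Proof.
have H : (G n)%:R = kappa * alpha ^+ n + (1 - kappa) * (a%:R - alpha) ^+ n :> R /\
  (G n.+1)%:R = kappa * alpha ^+ n.+1 + (1 - kappa) * (a%:R - alpha) ^+ n.+1 :> R.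
  elim: n => [|n [IH0 IH1]].
    rewrite !expr0 !expr1 !mulr1 addrC subrK; split=> //.
    have s0 : Num.sqrt (a%:R ^+ 2 + 4 * b%:R) != 0 :> R by rewrite gt_eqF ?sqrt_disc_gt0.
    rewrite /= -natr1 /kappa /alpha; move: s0; set s := Num.sqrt _ => s0.
    by field.
  split=> //; rewrite GseqSS natrD !natrM IH0 IH1.
  (* Eliminating b this way makes the recursion for the powers of both roots a polynomial
     identity. *)
  have e : b%:R = alpha ^+ 2 - a%:R * alpha by rewrite alpha_sqr; ring.
  rewrite e !exprSr; ring.
by case: H.
Qed.

(** The error is bounded uniformly in n, hence summable against alpha^(-n) in [mean_bound]. *)
Lemma Gseq_err n : `|(G n)%:R - kappa * alpha ^+ n| <= `|1 - kappa|.
Proof.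
rewrite Gseq_binet addrC addKr normrM ler_piMr // normrX exprn_ile1 //.
exact/ltW/alpha_conj_norm.
Qed.

Lemma alpha_exp_le n : alpha ^+ n <= (G n)%:R.
Proof.
have A0 := alpha_gt0; have e := alpha_sqr.
have ba : b%:R <= a%:R :> R by rewrite ler_nat; case/andP: hab.
suff [] : alpha ^+ n <= (G n)%:R /\ alpha ^+ n.+1 <= (G n.+1)%:R by [].
elim: n => [|n [IH0 IH1]].
  split=> //=; rewrite expr1 -natr1.
  have := alpha_conj_norm; have := ler_normr (alpha - a%:R) (alpha - a%:R).
  by rewrite distrC lexx /=; lra.
split=> //; rewrite GseqSS natrD !natrM.
rewrite -addn2 exprD e mulrDr lerD //.
  by rewrite mulrCA -exprSr ler_wpM2l.
by rewrite mulrC ler_wpM2l.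
Qed.

Lemma Gseq_alpha_cvg : (fun n => (G n)%:R / alpha ^+ n) @ \oo --> kappa.
Proof.
have A0 := alpha_gt0.
have -> : (fun n => (G n)%:R / alpha ^+ n) =
    (fun n => kappa + (1 - kappa) * ((a%:R - alpha) / alpha) ^+ n).
  apply/funext => n; rewrite Gseq_binet mulrDl mulfK ?expf_neq0 ?gt_eqF //.
  by rewrite -mulrA -expr_div_n.
rewrite -[X in _ --> X]addr0; apply: cvgD; first exact: cvg_cst.
rewrite -[X in _ --> X](mulr0 (1 - kappa)); apply: cvgM; first exact: cvg_cst.
apply: cvg_expr; rewrite normrM normfV (gtr0_norm A0) ltr_pdivrMr // mul1r.
exact: lt_trans alpha_conj_norm alpha_gt1.
Qed.

Lemma geometric_sum_le (q : R) n : 0 <= q < 1 ->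
  \sum_(0 <= j < n) q ^+ j <= (1 - q)^-1.
Proof.
move=> /andP[q0 q1]; rewrite -[leRHS]mul1r ler_pdivlMr ?subr_gt0 //.
have -> : (\sum_(0 <= j < n) q ^+ j) * (1 - q) = 1 - q ^+ n.
  elim: n => [|n IH]; first by rewrite big_geq // mul0r expr0 subrr.
  by rewrite big_nat_recr //= mulrDl IH exprSr; ring.
by rewrite gerBl exprn_ge0.
Qed.

(* Twice the sum of the weight [kappa] of [D_n] and of the total error made in replacing
   [G_n] by [kappa alpha^n], weighted by the geometric series of [1 / alpha]. *)
Definition mean_const : R :=
  2 * (kappa + `|1 - kappa| * a.+2%:R * (1 - alpha^-1)^-1).

Lemma mean_const_ge0 : 0 <= mean_const.
Proof.
have k0 := kappa_gt0; have A1 := alpha_gt1; have A0 := alpha_gt0.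
apply: mulr_ge0 => //; apply: addr_ge0; first exact: ltW.
by rewrite !mulr_ge0 // invr_ge0 subr_ge0 invf_le1 // ltW.
Qed.

(** Divide [total_rec] by alpha^(n+2) and use a / alpha = 1 - th: the combination mu_(n+1) + th mu_n
    then telescopes, with increments a multiple of D_(n+1) plus a geometrically small error. *)
Lemma mean_bound (g : nat -> R) (d : R) : greedy_additive a b g ->
    (forall m, (m < G 1)%N -> g m = 0) ->
    (forall n, digit_norm a b g n <= d) ->
    (forall n, `|\sum_(1 <= j < n.+1) Dterm a b g j| <= d) ->
  forall n, `|mean a b g n| <= mean_const * d.
Proof.
move=> hg g0 gd gD.
have A1 := alpha_gt1; have A0 := alpha_gt0; have k0 := kappa_gt0.
have d0 : 0 <= d by apply: le_trans (gd 0%N); exact: digit_norm_ge0.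
have total0 n : (n <= 1)%N -> total a b g n = 0.
  move=> n1; rewrite /total big_nat big1 // => m /andP[_ mn].
  by rewrite g0 // (leq_trans mn) // leq_Gseq.
pose q := alpha^-1; pose th := b%:R / alpha ^+ 2.
have q01 : 0 <= q < 1 by rewrite /q invr_ge0 ltW // invf_lt1.
pose mu n := total a b g n / alpha ^+ n.
pose s n : R := \sum_(0 <= k < a) g (k * G n)%N.
pose u n : R := b%:R * g (a * G n.+1)%N + \sum_(0 <= k < b) g (k * G n)%N.
pose err n := ((G n.+1)%:R - kappa * alpha ^+ n.+1) * s n.+1
  + ((G n)%:R - kappa * alpha ^+ n) * u n.
have from1 c n : \sum_(1 <= k < c) g (k * G n)%N = \sum_(0 <= k < c) g (k * G n)%N.
  case: c => [|c]; first by rewrite !big_geq.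
  by rewrite [RHS]big_nat_recl // mul0n hg.1 add0r big_add1.
have DE n : Dterm a b g n.+1 = alpha * s n.+1 + u n.
  by rewrite /Dterm !from1 /s /u /=; ring.
(* One d bounds s, and b + 1 <= a + 1 of them bound u, whence a + 2. *)
have errle n : `|err n| <= `|1 - kappa| * a.+2%:R * d.
  have sd : `|s n.+1| <= d by apply: le_trans (gd n.+1); apply: digit_sum_le.
  have ud : `|u n| <= a.+1%:R * d.
    apply: (le_trans (ler_normD _ _)); rewrite normrM ger0_norm // -natr1 mulrDl mul1r.
    apply: lerD; last first.
      apply: le_trans (gd n); apply: digit_sum_le => //.
      by case/andP: hab => _ /leqW.
    apply: ler_pM => //; first by rewrite ler_nat; case/andP: hab.
    by apply: le_trans (gd n.+1); apply: digit_le_norm.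
  apply: (le_trans (ler_normD _ _)); rewrite !normrM -[a.+2%:R]natr1.
  have -> : `|1 - kappa| * (a.+1%:R + 1) * d =
     `|1 - kappa| * d + `|1 - kappa| * (a.+1%:R * d) by ring.
  by apply: lerD; apply: ler_pM => //; exact: Gseq_err.
have step n : mu n.+2 + th * mu n.+1 = mu n.+1 + th * mu n
    + (kappa / alpha ^+ 2 * Dterm a b g n.+1 + err n * q ^+ 2 * q ^+ n).
  rewrite /mu total_rec // -/(s n.+1) -/(u n) DE /err /th /q.
  have ea : b%:R = alpha ^+ 2 - a%:R * alpha by rewrite alpha_sqr; ring.
  rewrite -!exprVn !exprS expr0 !exprVn ea; field; rewrite ?expf_neq0 ?gt_eqF //.
have v n : mu n.+1 + th * mu n = kappa / alpha ^+ 2 *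
   \sum_(1 <= j < n.+1) Dterm a b g j + \sum_(0 <= j < n) err j * q ^+ 2 * q ^+ j.
  elim: n => [|n IH].
    by rewrite /mu !total0 // !big_geq // !mul0r !mulr0 !addr0.
  rewrite step IH; move: (Dterm a b g) => D; rewrite [\sum_(1 <= j < n.+2) _]big_nat_recr //=.
  rewrite [\sum_(0 <= j < n.+1) _]big_nat_recr //=.
  by rewrite mulrDr; ring.
have ka0 : 0 <= kappa / alpha ^+ 2 by rewrite ltW // divr_gt0 ?exprn_gt0.
have vle n : `|mu n.+1 + th * mu n| <= mean_const / 2 * d.
  rewrite v /mean_const [2 * _]mulrC mulfK // mulrDl.
  apply: le_trans (ler_normD _ _) _; apply: lerD.
    rewrite normrM (ger0_norm ka0); apply: ler_pM => //.
    by rewrite ler_pdivrMr ?exprn_gt0 // ler_peMr ?exprn_ege1 ?(ltW A1) ?(ltW k0).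
  apply: le_trans (ler_norm_sum _ _ _) _.
  have -> : `|1 - kappa| * a.+2%:R * (1 - alpha^-1)^-1 * d =
     `|1 - kappa| * a.+2%:R * d * (1 - q)^-1 by rewrite /q; ring.
  apply: (@le_trans _ _ (`|1 - kappa| * a.+2%:R * d * \sum_(0 <= j < n) q ^+ j)).
    rewrite mulr_sumr; apply: ler_sum => j _; case/andP: q01 => q0 q1.
    rewrite !normrM !normrX (ger0_norm q0).
    apply: ler_wpM2r; first exact: exprn_ge0.
    apply: le_trans (errle j); apply: ler_piMr => //.
    by apply: mulr_ile1 => //; exact: ltW.
  by apply: ler_wpM2l; [rewrite !mulr_ge0 | exact: geometric_sum_le].
have th0 : 0 <= th by rewrite divr_ge0 // ltW // exprn_gt0.
have th2 : th <= 1 / 2 := alpha_theta_le.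
have md : 0 <= mean_const * d by rewrite mulr_ge0 // mean_const_ge0.
(* The combination takes half of [mean_const * d] and th <= 1/2 times the previous bound takes the
   other half; hence the factor 2 in [mean_const]. *)
have mule n : `|mu n| <= mean_const * d.
  elim: n => [|n IH]; first by rewrite /mu total0 // mul0r normr0.
  have -> : mu n.+1 = (mu n.+1 + th * mu n) - th * mu n by ring.
  apply: le_trans (ler_normB _ _) _; rewrite normrM (ger0_norm th0).
  have := vle n; have : th * `|mu n| <= 1 / 2 * (mean_const * d) by apply: ler_pM.
  lra.
(* [mean] divides by G_n, which is at least alpha^n. *)
move=> n; apply: le_trans (mule n).
rewrite /mean /mu !normrM ler_wpM2l // !normfV.
rewrite !gtr0_norm ?exprn_gt0 ?Gseq_gt0R // lef_pV2 ?posrE ?exprn_gt0 ?Gseq_gt0R //.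
exact: alpha_exp_le.
Qed.

End Growth.

(** * Equidistribution of the low digits *)

Section Equidistribution.
Context (R : realType) (a b : nat) (hab : (1 <= b <= a)%N).
Local Notation G := (Gseq a b).

Definition avg (h : nat -> R) N : R := (\sum_(0 <= m < N) h m) / N%:R.

Lemma ler_avg (h h' : nat -> R) N : (forall m, h m <= h' m) -> avg h N <= avg h' N.
Proof. by move=> hh; rewrite ler_wpM2r // ler_sum. Qed.

Lemma avgD (h h' : nat -> R) N : avg (fun m => h m + h' m) N = avg h N + avg h' N.
Proof. by rewrite /avg big_split /= mulrDl. Qed.

Lemma avg01 (h : nat -> R) N : (forall m, 0 <= h m <= 1) -> 0 <= avg h N <= 1.
Proof.
move=> h01; have s0 : 0 <= \sum_(0 <= m < N) h m by apply: sumr_ge0 => m _; case/andP: (h01 m).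
rewrite divr_ge0 //=.
case: N {s0} => [|N]; first by rewrite /avg invr0 mulr0.
rewrite ler_pdivrMr // mul1r -[leRHS]mulr1 -sum_const_nat0.
by apply: ler_sum => m _; case/andP: (h01 m).
Qed.

Section LowDigits.
Context (K : nat) (h : nat -> R).
Context (h01 : forall m, 0 <= h m <= 1).
Context (h_add : forall n k m, (K <= n)%N -> (m < G n)%N ->
  (k * G n + m < G n.+1)%N -> h (k * G n + m)%N = h m).

Let s n := avg h (G n).
Let T N := \sum_(0 <= m < N) h m.

Lemma low_avgE n : T (G n) = s n * (G n)%:R.
Proof. by rewrite /s /avg divfK // gt_eqF // Gseq_gt0R. Qed.

(** From index K on, the leading digit is invisible to [h], so its sums obey the recursion of G
    without source term. *)
Lemma low_sum_rec n : (K <= n)%N ->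
  T (G n.+2) = a%:R * T (G n.+1) + b%:R * T (G n).
Proof.
move=> Kn; rewrite /T sum_Gseq_split // -2!sum_const_nat0; congr (_ + _).
  apply: eq_big_nat => k /andP[_ ka]; apply: eq_big_nat => m /andP[_ mn].
  rewrite h_add ?leqW // GseqSS; have := Gseq_gt0 hab n; nia.
apply: eq_big_nat => k /andP[_ kb]; apply: eq_big_nat => m /andP[_ mn].
have km : (k * G n + m < G n.+1)%N by have := Gseq_leS hab n; nia.
by rewrite h_add ?leqW ?GseqSS //; [rewrite h_add | nia].
Qed.

(** s_(n+2) is a weighted mean of s_(n+1) and s_n in which s_n has weight b G_n / G_(n+2) <= 1/2, so
    the increments at least halve. *)
Lemma low_avg_step i : `|s (K + i).+1 - s (K + i)| <= (2^-1) ^+ i.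
Proof.
elim: i => [|i IH].
  rewrite expr0 addn0 ler_norml.
  by have := avg01 (G K) h01; have := avg01 (G K.+1) h01; rewrite /s; lra.
rewrite addnS; have := low_sum_rec (leq_addr i K); rewrite !low_avgE.
set n := (K + i)%N in IH *; rewrite GseqSSR // => e.
have g0 := Gseq_gt0R R hab n; have g1 := Gseq_gt0R R hab n.+1.
have g01 := Gseq_leR R hab (leqnSn n).
have ba : b%:R <= a%:R :> R by rewrite ler_nat; case/andP: hab.
have b1 : 1 <= b%:R :> R by rewrite ler1n; case/andP: hab.
have g2 : 0 < a%:R * (G n.+1)%:R + b%:R * (G n)%:R :> R by nra.
rewrite -(ler_pM2l g2) -{1}[_ + _]gtr0_norm // -normrM.
have -> : (a%:R * (G n.+1)%:R + b%:R * (G n)%:R) * (s n.+2 - s n.+1) =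
  - (b%:R * (G n)%:R) * (s n.+1 - s n) by rewrite mulrBr [X in X - _]mulrC e; ring.
rewrite normrM normrN (ger0_norm (mulr_ge0 (ler0n _ _) (ltW g0))) exprS mulrA.
apply: ler_pM => //.
have := ler_pM (ler0n R b) (ltW g0) ba g01; lra.
Qed.

Lemma low_avg_cauchy i j : `|s (K + i + j) - s (K + i)| <= 2 * (2^-1) ^+ i * (1 - (2^-1) ^+ j).
Proof.
elim: j => [|j IH]; first by rewrite addn0 subrr normr0 expr0 subrr mulr0.
have := low_avg_step (i + j); rewrite addnA -addnS exprD => st.
have -> : s (K + i + j.+1) - s (K + i) =
  (s (K + i + j.+1) - s (K + i + j)) + (s (K + i + j) - s (K + i)) by ring.
apply: le_trans (ler_normD _ _) _; rewrite exprS; lra.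
Qed.

(** Strong induction on N = k G_n + r: over k full blocks [h] repeats itself with average within
    2^(1-i) of s_(K+i), and r goes to the induction hypothesis. The additive G_(K+i) is paid once,
    when the remainder drops below G_(K+i). *)
Lemma low_sum_approx i N :
  `|T N - s (K + i) * N%:R| <= 2 * (2^-1) ^+ i * N%:R + (G (K + i))%:R.
Proof.
have /andP[s0 s1] : 0 <= s (K + i) <= 1 by exact: avg01.
set e := 2 * _.
have e0 : 0 <= e by rewrite /e mulr_ge0 // exprn_ge0.
elim: N {-2}N (leqnn N) => [|L IH] N NL.
  have -> : N = 0%N by lia.
  by rewrite /T big_geq // !mulr0 subr0 normr0 add0r.
have [NG|GN] := ltnP N (G (K + i)).
  have T0 : 0 <= T N by apply: sumr_ge0 => m _; case/andP: (h01 m).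
  have TN : T N <= N%:R.
    by rewrite -[leRHS]mulr1 -sum_const_nat0; apply: ler_sum => m _; case/andP: (h01 m).
  have GR : N%:R <= (G (K + i))%:R :> R by rewrite ler_nat ltnW.
  have N0 : 0 <= N%:R :> R by [].
  have sN : s (K + i) * N%:R <= N%:R by rewrite ler_piMl.
  have sN0 : 0 <= s (K + i) * N%:R by rewrite mulr_ge0.
  have eN : 0 <= e * N%:R by rewrite mulr_ge0.
  by rewrite ler_norml; lra.
have N0 : (0 < N)%N by apply: leq_trans GN; exact: Gseq_gt0.
have [n /andP[nN Nn]] := Gseq_bracket hab N0.
have Kn : (K + i <= n)%N.
  rewrite leqNgt; apply/negP => /(leq_Gseq hab); lia.
have Gn := Gseq_gt0 hab n.
have dN := divn_eq N (G n); have mN := ltn_pmod N Gn.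
have k1 : (1 <= N %/ G n)%N by rewrite divn_gt0.
move: (N %/ G n)%N (N %% G n)%N dN mN k1 => k r dN rn k1.
have TE : T N = k%:R * T (G n) + T r.
  rewrite /T dN (@big_cat_nat _ _ _ (k * G n)) ?leq_addr //= sum_block.
  congr (_ + _).
    rewrite -sum_const_nat0.
    apply: eq_big_nat => j /andP[_ jk]; apply: eq_big_nat => m /andP[_ mn].
    by rewrite h_add //; [exact: leq_trans (leq_addr _ _) Kn | nia].
  rewrite -{1}[(k * G n)%N]add0n big_addn addKn.
  apply: eq_big_nat => m /andP[_ mr]; rewrite addnC h_add //; last by lia.
    exact: leq_trans (leq_addr _ _) Kn.
  exact: ltn_trans mr rn.
have IHr : `|T r - s (K + i) * r%:R| <= e * r%:R + (G (K + i))%:R.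
  by apply: IH; nia.
have sn : `|s n - s (K + i)| <= e.
  have := low_avg_cauchy i (n - (K + i)); rewrite subnKC //.
  move/le_trans; apply; rewrite -/e ler_piMr // gerBl exprn_ge0 //.
rewrite TE low_avgE.
have -> : k%:R * (s n * (G n)%:R) + T r - s (K + i) * N%:R =
   (s n - s (K + i)) * (k * G n)%:R + (T r - s (K + i) * r%:R).
  rewrite dN natrD natrM; ring.
apply: le_trans (ler_normD _ _) _; rewrite dN natrD mulrDr -addrA lerD //.
by rewrite normrM [`|_%:R|]ger0_norm // ler_wpM2r.
Qed.

End LowDigits.

(* The rank [N0] does not depend on [h]; this makes the later estimates uniform in [x]. *)
Lemma low_equidistribution K (e : R) : 0 < e -> exists N0, forall N M,
  (N0 <= N)%N -> (N0 <= M)%N -> forall h : nat -> R,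
  (forall m, 0 <= h m <= 1) ->
  (forall n k m, (K <= n)%N -> (m < G n)%N ->
     (k * G n + m < G n.+1)%N -> h (k * G n + m)%N = h m) ->
  avg h N <= avg h M + e.
Proof.
move=> e0.
have [i hi] : exists i, 2 * (2^-1) ^+ i <= e / 4 :> R.
  have : (fun i => (2^-1 : R) ^+ i) @ \oo --> (0 : R).
    by apply: cvg_expr; rewrite ger0_norm ?invf_lt1 ?ltr1n.
  move/cvgrPdist_le => /(_ (e / 8)) [|i _ /(_ i (leqnn i))]; first by rewrite divr_gt0.
  rewrite /= sub0r normrN ger0_norm ?exprn_ge0 // => hi; exists i; lra.
have [N0 hN0] : exists N0 : nat, (G (K + i))%:R / (e / 4) < N0%:R.
  by exists (Num.bound ((G (K + i))%:R / (e / 4))); apply: archi_boundP; rewrite !divr_ge0 // ltW.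
exists N0.+1 => N M NN NM h h01 h_add.
have main L : (N0 < L)%N -> `|avg h L - avg h (G (K + i))| <= e / 2.
  move=> NL; have := low_sum_approx h01 h_add i L.
  have L0 : 0 < L%:R :> R by rewrite ltr0n; lia.
  have GL : (G (K + i))%:R <= e / 4 * L%:R.
    rewrite mulrC -ler_pdivrMr ?divr_gt0 //; apply: ltW; apply: lt_le_trans hN0 _.
    by rewrite ler_nat ltnW.
  have -> : avg h L - avg h (G (K + i)) =
     (\sum_(0 <= m < L) h m - avg h (G (K + i)) * L%:R) / L%:R.
    by rewrite mulrBl mulfK ?gt_eqF.
  rewrite normrM normfV (gtr0_norm L0) ler_pdivrMr // => /le_trans; apply.
  have := ler_wpM2r (ltW L0) hi; lra.
have := main _ NN; have := main _ NM; rewrite !ler_norml; lra.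
Qed.

End Equidistribution.

(** * The tail of an additive function *)

Lemma cvgn_near_cauchy (R : realType) (u : nat -> R) (e : R) : cvgn u -> 0 < e ->
  exists N0, forall n m, (N0 <= n)%N -> (N0 <= m)%N -> `|u n - u m| <= e.
Proof.
move=> cu e0; have /cvgrPdist_le/(_ (e / 2)) : u @ \oo --> limn u by exact: cu.
move=> [|N0 _ hN]; first by rewrite divr_gt0.
exists N0 => n m /hN /= + /hN /=; rewrite !ler_norml; lra.
Qed.

Section Tail.
Context (R : realType) (a b : nat) (hab : (1 <= b <= a)%N) (f : nat -> R).
Local Notation G := (Gseq a b).
Context (hf : greedy_additive a b f).
Context (hD : cvgn (fun N : nat => \sum_(1 <= n < N) Dterm a b f n : R)).
Context (hf2 : cvgn (fun N : nat =>
       \sum_(0 <= n < N) \sum_(1 <= k < a.+1) f (k * Gseq a b n)%N ^+ 2 : R)).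

Definition tail K m : R := f m - f (low_part hab K m).

Lemma tail_greedy K : greedy_additive a b (tail K).
Proof. exact: greedy_low_sub. Qed.

Lemma tail_digit K n k : (k <= a)%N ->
  tail K (k * G n)%N = if (K <= n)%N then f (k * G n)%N else 0.
Proof.
move=> ka; rewrite /tail greedy_low_digit //.
case: n => [|n]; first by rewrite muln1 /=; lia.
by have := Gseq_gt0 hab n; rewrite GseqSS; nia.
Qed.

Lemma digit_norm_tail K n :
  digit_norm a b (tail K) n = if (K <= n)%N then digit_norm a b f n else 0.
Proof.
rewrite /digit_norm; case: ifP => Kn.
  by apply: eq_big_nat => k /andP[_ ka]; rewrite tail_digit ?Kn.
by rewrite big_nat big1 // => k /andP[_ ka]; rewrite tail_digit ?Kn ?normr0.
Qed.

(* At index [K] only part of [D_K] survives, because the digit of index [K - 1] is erased. *)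
Lemma Dterm_tail K n : (0 < n)%N ->
  Dterm a b (tail K) n =
  if (K < n)%N then Dterm a b f n else
  if n == K then alpha R a b * \sum_(1 <= k < a) f (k * G n)%N + b%:R * f (a * G n)%N
  else 0.
Proof.
case: n => // n _; have [b1 ba] := andP hab.
have S1 c p : (c <= a.+1)%N -> \sum_(1 <= k < c) tail K (k * G p)%N =
    if (K <= p)%N then \sum_(1 <= k < c) f (k * G p)%N else 0.
  move=> ca; case: ifP => Kp.
    by apply: eq_big_nat => k /andP[_ kc]; rewrite tail_digit ?Kp //; lia.
  by rewrite big_nat big1 // => k /andP[_ kc]; rewrite tail_digit ?Kp //; lia.
rewrite /Dterm succnK (S1 a n.+1 (leqnSn a)) (S1 b n (leqW ba)) tail_digit // ltnS.
rewrite [(K <= n.+1)%N]leq_eqVlt ltnS.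
rewrite [n.+1 == K]eq_sym.
by case: (leqP K n) => Kn; rewrite ?orbT ?orbF //; case: eqP => // _;
  rewrite ?mulr0 ?addr0.
Qed.

(** The second moment is the variance plus the squared mean, bounded by [sqdev_bound] and
    [mean_bound] once K lies beyond the Cauchy ranks of both series. *)
Lemma tail_second_moment (eta : R) : 0 < eta -> exists K, forall n,
  \sum_(0 <= m < G n) tail K m ^+ 2 <= eta * (G n)%:R.
Proof.
move=> eta0.
have A0 := alpha_gt0 R hab.
pose c2 : R := mean_const R a b * (alpha R a b + b%:R + 1).
pose c1 : R := 8 * (1 + 16 * a.+1%:R ^+ 2).
have c10 : 0 <= c1 by rewrite mulr_ge0 // addr_ge0 // mulr_ge0 // sqr_ge0.
have C0 : 0 < c1 + c2 ^+ 2 + 1 by rewrite ltr_wpDl // addr_ge0 // sqr_ge0.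
pose d : R := Num.sqrt (eta / (c1 + c2 ^+ 2 + 1)).
have d20 : 0 < eta / (c1 + c2 ^+ 2 + 1) by rewrite divr_gt0.
have d0 : 0 < d by rewrite sqrtr_gt0.
have dE : (c1 + c2 ^+ 2) * d ^+ 2 <= eta.
  rewrite sqr_sqrtr ?(ltW d20) // mulrCA ler_piMr ?(ltW eta0) //.
  by rewrite ler_pdivrMr // mul1r lerDl.
have [K1 hK1] := cvgn_near_cauchy hD d0.
(* The denominator pays for the factor a in [digit_norm_sqr]. *)
have ea : 0 < d ^+ 2 / a.+1%:R by rewrite divr_gt0 ?exprn_gt0.
have [K2 hK2] := cvgn_near_cauchy hf2 ea.
(* The successor gives K >= 1, so that the tail vanishes below G_1. *)
pose K := (maxn K1 K2).+1.
have K1K : (K1 <= K)%N by rewrite leqW // leq_maxl.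
have K2K : (K2 <= K)%N by rewrite leqW // leq_maxr.
exists K => n.
have tg := tail_greedy K.
have t0 m : (m < G 1)%N -> tail K m = 0.
  move=> m1; rewrite /tail low_part_id ?subrr //.
  exact: leq_trans m1 (leq_Gseq hab (ltn0Sn _)).
have E1 p : \sum_(0 <= j < p) digit_norm a b (tail K) j ^+ 2 <= d ^+ 2.
  have [pK|Kp] := leqP p K.
    rewrite big_nat big1 ?sqr_ge0 // => j /andP[_ jp].
    by rewrite digit_norm_tail leqNgt (leq_trans jp pK) /= expr0n.
  rewrite (@big_cat_nat _ _ _ K) ?(ltnW Kp) //= big_nat big1 ?add0r; last first.
    by move=> j /andP[_ jK]; rewrite digit_norm_tail leqNgt jK /= expr0n.
  have := hK2 p K (leq_trans K2K (ltnW Kp)) K2K.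
  rewrite (@big_cat_nat _ _ _ K) ?(ltnW Kp) //= addrC addrK => h.
  apply: (@le_trans _ _ (a%:R * \sum_(K <= j < p) \sum_(1 <= k < a.+1) f (k * G j)%N ^+ 2)).
    rewrite mulr_sumr; apply: ler_sum_nat => j /andP[Kj _].
    by rewrite digit_norm_tail Kj digit_norm_sqr.
  apply: (@le_trans _ _ (a.+1%:R * (d ^+ 2 / a.+1%:R))); last by rewrite mulrC divfK.
  apply: ler_pM => //; last 1 first.
  - exact: le_trans (ler_norm _) h.
  - by apply: sumr_ge0 => j _; apply: sumr_ge0 => k _; exact: sqr_ge0.
  - by rewrite ler_nat.
have nd p : digit_norm a b (tail K) p <= d.
  rewrite -ler_sqr ?nnegrE ?(ltW d0) ?digit_norm_ge0 //.
  apply: le_trans (E1 p.+1); rewrite big_nat_recr //= lerDr.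
  by apply: sumr_ge0 => j _; exact: sqr_ge0.
(* alpha + b covers the truncated term at index K, which only the digit norm controls; the 1 covers
   the later terms, by the Cauchy property of the sums of [Dterm]. *)
pose d2 := (alpha R a b + b%:R + 1) * d.
have nd2 p : digit_norm a b (tail K) p <= d2.
  apply: le_trans (nd p) _; rewrite /d2 ler_peMl ?(ltW d0) // lerDr.
  by rewrite addr_ge0 // ltW.
have tailK k : (k <= a)%N -> tail K (k * G K)%N = f (k * G K)%N.
  by move=> ka; rewrite tail_digit // leqnn.
have DK : `|alpha R a b * \sum_(1 <= k < a) f (k * G K)%N + b%:R * f (a * G K)%N|
     <= (alpha R a b + b%:R) * d.
  apply: le_trans (ler_normD _ _) _.
  rewrite (normrM (alpha R a b)) (normrM b%:R) (gtr0_norm A0) (ger0_norm (ler0n R b)).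
  rewrite mulrDl; apply: lerD; apply: ler_pM => //; try exact: ltW.
    rewrite (_ : \sum_(1 <= k < a) _ = \sum_(0 <= k < a) tail K (k * G K)%N).
      by apply: le_trans (nd K); apply: digit_sum_le.
    case: (a) (tailK) => [|c] tK; first by rewrite !big_geq.
    rewrite [RHS]big_nat_recl // mul0n tg.1 add0r big_add1 /=.
    by apply: eq_big_nat => k /andP[_ kc]; rewrite tK // ltnW.
  rewrite -tailK //; apply: le_trans (nd K); exact: digit_le_norm.
have gD p : `|\sum_(1 <= j < p.+1) Dterm a b (tail K) j| <= d2.
  have d2d : (alpha R a b + b%:R) * d + d = d2 by rewrite /d2; ring.
  have z j : (0 < j < K)%N -> Dterm a b (tail K) j = 0.
    by move=> /andP[j0 jK]; rewrite Dterm_tail // ltnNge (ltnW jK) (ltn_eqF jK).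
  have [pK|Kp] := ltnP p K.
    rewrite big_nat big1 ?normr0; last first.
      by move=> j /andP[j0 jp]; rewrite z // j0 (leq_trans jp).
    by rewrite mulr_ge0 ?addr_ge0 // ltW.
  rewrite (@big_cat_nat _ _ _ K) ?(leqW Kp) //= big_nat big1 ?add0r; last by move=> j /z.
  rewrite big_ltn ?ltnS //; have -> : Dterm a b (tail K) K =
     alpha R a b * \sum_(1 <= k < a) f (k * G K)%N + b%:R * f (a * G K)%N.
    by rewrite Dterm_tail // ltnn eqxx.
  rewrite -d2d; apply: le_trans (ler_normD _ _) _; apply: lerD => //.
  rewrite (_ : \sum_(K.+1 <= j < p.+1) _ = \sum_(K.+1 <= j < p.+1) Dterm a b f j); last first.
    by apply: eq_big_nat => j /andP[Kj _]; rewrite Dterm_tail ?Kj //; lia.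
  have := hK1 p.+1 K.+1 (leq_trans K1K (leqW Kp)) (leqW K1K).
  by rewrite [X in X - _](@big_cat_nat _ _ _ K.+1) //= addrC addrK.
have V := sqdev_bound hab tg t0 E1 n.
have M := mean_bound hab tg t0 nd2 gD n.
have := sum_sqr_shift hab (tail K) n (mean a b (tail K) n).
under eq_bigr do rewrite subrK.
move=> ->; have G0 := Gseq_gt0R R hab n.
have : mean a b (tail K) n ^+ 2 <= c2 ^+ 2 * d ^+ 2.
  have c2d : c2 * d = mean_const R a b * d2 by rewrite /c2 /d2 mulrA.
  rewrite -exprMn c2d -(real_normK (num_real (mean _ _ _ _))) ler_sqr ?nnegrE //.
  exact: le_trans (normr_ge0 _) M.
move=> /(ler_wpM2l (ltW G0)); have := ler_wpM2r (ltW G0) dE.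
rewrite -/c1 in V; lra.
Qed.

(** Chebyshev's inequality: a mean square of at most e^3 against the threshold e^2 leaves a
    frequency of at most e. *)
Lemma tail_frequency (e : R) : 0 < e -> exists K, forall N,
  avg (fun m => (e < `|tail K m|)%R%:R) N <= e.
Proof.
move=> e0; have eta0 : 0 < e ^+ 3 / a.+1%:R by rewrite divr_gt0 ?exprn_gt0.
have [K hK] := tail_second_moment eta0; exists K => N.
have [->|N0] := posnP N; first by rewrite /avg invr0 mulr0 ltW.
(* Going from [N] up to [G_(n+1) <= (a + 1) N] costs only the factor [a + 1]. *)
have [n /andP[nN Nn]] := Gseq_bracket hab N0.
have NR : 0 < N%:R :> R by rewrite ltr0n.
rewrite ler_pdivrMr // -(ler_pM2l (exprn_gt0 2 e0)) mulr_sumr.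
apply: (@le_trans _ _ (\sum_(0 <= m < G n.+1) tail K m ^+ 2)).
  rewrite [leRHS](@big_cat_nat _ _ _ N) ?(ltnW Nn) //=.
  apply: ler_wpDr; first by apply: sumr_ge0 => m _; exact: sqr_ge0.
  apply: ler_sum => m _; case: ltP => h; last by rewrite mulr0 sqr_ge0.
  rewrite mulr1 -[leRHS](real_normK (num_real _)) ler_sqr ?nnegrE //; exact: ltW.
apply: le_trans (hK _) _.
have : (G n.+1)%:R <= a.+1%:R * N%:R :> R.
  by rewrite -natrM ler_nat (leq_trans (G_step n hab)) // leq_mul2l nN orbT.
have a1 : 0 < a.+1%:R :> R by [].
move/(ler_wpM2l (ltW eta0))/le_trans; apply.
by rewrite mulrA divfK ?gt_eqF // mulrA -exprSr.
Qed.

Definition edf N (x : R) : R := avg (fun m => (f m <= x)%R%:R) N.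

(** Three losses of e/3: replacing [f] by its low part at N, equidistribution from N to M, and
    restoring [f] at M. Each replacement also moves the threshold. *)
Lemma edf_levy_cauchy (e : R) : 0 < e -> exists N0, forall N M,
  (N0 <= N)%N -> (N0 <= M)%N -> forall x, edf N x <= edf M (x + e) + e.
Proof.
move=> e0; have e3 : 0 < e / 3 by rewrite divr_gt0.
have [K hK] := tail_frequency e3.
have [N0 hN0] := low_equidistribution hab K e3; exists N0 => N M NN NM x.
pose h m : R := (f (low_part hab K m) <= x + e / 3)%R%:R.
have b01 (c : bool) : 0 <= (c%:R : R) <= 1 by case: c; rewrite /= ?lexx ?ler01.
have indic (p q r y z : R) : q = p - r -> y + e / 3 <= z ->
    (p <= y)%R%:R <= (q <= z)%R%:R + (e / 3 < `|r|)%R%:R :> R.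
  move=> -> yz; case: (ltP (e / 3)) => [_|].
    by rewrite ler_wpDl //; case: (p <= y)%R.
  rewrite ler_norml => /andP[r1 _]; rewrite addr0.
  by case: (leP p y) => // py; rewrite (_ : (p - r <= _)%R) //; lra.
have h1 : edf N x <= avg h N + e / 3.
  apply: le_trans (lerD (lexx _) (hK N)); rewrite -avgD; apply: ler_avg => m.
  by apply: indic => //; rewrite /tail; ring.
have h2 : avg h M <= edf M (x + e) + e / 3.
  apply: le_trans (lerD (lexx _) (hK M)); rewrite -avgD; apply: ler_avg => m.
  by rewrite -normrN; apply: indic; [rewrite /tail; ring | lra].
have h3 : avg h N <= avg h M + e / 3.
  apply: hN0 => // [m|n k m Kn mn km]; first exact: b01.
  by rewrite /h low_part_add.
lra.
Qed.

End Tail.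

(** * Limits of Levy-Cauchy sequences of distribution functions *)

Section LevyLimit.
Context (R : realType) (E : nat -> R -> R).
Context (E_mono : forall N x y, x <= y -> E N x <= E N y).
Context (E01 : forall N x, 0 <= E N x <= 1).
Context (E_tails : forall N, exists A : R, 1 <= E N.+1 A /\ E N.+1 (- A) <= 0).
Context (E_levy : forall e : R, 0 < e -> exists N0, forall N M,
  (N0 <= N)%N -> (N0 <= M)%N -> forall x, E N x <= E M (x + e) + e).

(** The infimum of this set is the infimum over y > x of limsup E_N(y); the strict y > x builds in
    right continuity. *)
Let upper x : set R :=
  [set z | exists2 y, x < y & exists N0, forall N, (N0 <= N)%N -> E N y <= z].

Definition levy_limit x : R := inf (upper x).
Local Notation F := levy_limit.

Lemma levy_upper_ge0 x z : upper x z -> 0 <= z.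
Proof. by move=> [y _ [N0 /(_ _ (leqnn _))]]; apply: le_trans; case/andP: (E01 N0 y). Qed.

Lemma levy_upper1 x : upper x 1.
Proof. by exists (x + 1); [rewrite ltrDl | exists 0%N => N _; case/andP: (E01 N (x + 1))]. Qed.

Lemma levy_has_inf x : has_inf (upper x).
Proof. by split; [exists 1; exact: levy_upper1 | exists 0 => z /levy_upper_ge0]. Qed.

Lemma levy_limit_le x z : upper x z -> F x <= z.
Proof. by move=> xz; apply: ge_inf => //; exists 0 => y /levy_upper_ge0. Qed.

Lemma levy_limit_ge x z : (forall y, upper x y -> z <= y) -> z <= F x.
Proof. by move=> h; apply: lb_le_inf => //; exists 1; exact: levy_upper1. Qed.

Lemma levy_limit_adherent x e : 0 < e -> exists2 z, upper x z & z < F x + e.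
Proof. by move=> e0; apply: inf_adherent => //; exact: levy_has_inf. Qed.

Lemma levy_limit_nd : nondecreasing F.
Proof.
move=> x y xy; apply: levy_limit_ge => z [w yw h]; apply: levy_limit_le.
by exists w => //; exact: le_lt_trans xy yw.
Qed.

Lemma levy_limit_rc : right_continuous F.
Proof.
move=> x; apply/cvgrPdist_le => e e0.
have [z [y xy h] zF] := levy_limit_adherent x e0.
near=> w.
have xw : x < w by near: w; exact: nbhs_right_gt.
have wy : w < y by near: w; exact: nbhs_right_lt.
have Fw : F w <= z by apply: levy_limit_le; exists y.
have := levy_limit_nd (ltW xw); rewrite ler_norml; lra.
Unshelve. all: by end_near. Qed.

(** No mass escapes: one function E_(N0+1) is at most 0 at -A, and Levy closeness passes this on to
    all later ones. *)
Lemma levy_limitNy : F @ -oo --> (0 : R).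
Proof.
apply/cvgrPdist_le => e e0; have e2 : 0 < e / 2 by rewrite divr_gt0.
have [N0 hN] := E_levy e2; have [A [_ A0]] := E_tails N0.
exists (- A - e); split; first exact: num_real.
move=> x xA /=.
have Fx : F x <= e / 2.
  apply: levy_limit_le; exists (- A - e / 2); first by lra.
  exists N0 => N NN; have := hN N N0.+1 NN (leqnSn _) (- A - e / 2).
  rewrite subrK; lra.
have F0 : 0 <= F x by apply: levy_limit_ge => z /levy_upper_ge0.
rewrite ler_norml; lra.
Qed.

Lemma levy_limity : F @ +oo --> (1 : R).
Proof.
apply/cvgrPdist_le => e e0.
have [N0 hN] := E_levy e0; have [A [A1 _]] := E_tails N0.
exists (A + e); split; first exact: num_real.
move=> x xA /=.
have Fx : F x <= 1 by apply: levy_limit_le; exact: levy_upper1.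
have F0 : 1 - e <= F x.
  apply: levy_limit_ge => z [y xy [N1 h]].
  have := h _ (leq_maxr N0 N1).
  have := hN N0.+1 _ (leqnSn _) (leq_maxl N0 N1) A.
  have : E (maxn N0 N1) (A + e) <= E (maxn N0 N1) y by apply: E_mono; lra.
  lra.
rewrite ler_norml; lra.
Qed.

Lemma levy_limit_cvg x : {for x, continuous F} -> (fun N => E N x) @ \oo --> F x.
Proof.
move=> Fc; apply/cvgrPdist_le => e e0.
have e2 : 0 < e / 2 by rewrite divr_gt0.
have [z [y xy [N1 h1]] zF] := levy_limit_adherent x e0.
have /cvgrPdist_le/(_ _ e2) [r /= r0 hr] := Fc.
pose d := Num.min (r / 4) (e / 2).
have d0 : 0 < d by rewrite lt_min e2 divr_gt0.
have dr : d <= r / 4 by rewrite ge_min lexx.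
have de : d <= e / 2 by rewrite ge_min lexx orbT.
have [N0 hN] := E_levy d0.
exists (maxn N0 N1) => // N /=; rewrite geq_max => /andP[N0N N1N].
have up : E N x <= z by apply: le_trans (h1 N N1N); apply: E_mono; exact: ltW.
(* One d separates x - d strictly from the argument of [F], the other is the Levy shift; continuity
   at x then compares F(x - 2d) with F(x). *)
have lo : F (x - 2 * d) <= E N x + d.
  apply: levy_limit_le; exists (x - d); first by lra.
  by exists N0 => M NM; have := hN M N NM N0N (x - d); rewrite subrK.
have := hr (x - 2 * d); rewrite /= opprB addrCA subrr addr0 gtr0_norm; last by lra.
have rd : 2 * d < r by lra.
by move=> /(_ rd); rewrite !ler_norml; lra.
Qed.

Lemma levy_cauchy_limit : exists F : cumulativeBounded (0 : R) (1 : R),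
  forall x, {for x, continuous F} -> (fun N => E N x) @ \oo --> F x.
Proof.
pose c := HB.pack_for (cumulativeBounded (0 : R) (1 : R)) levy_limit
  (isCumulative.Build R _ R levy_limit levy_limit_nd levy_limit_rc)
  (isCumulativeBounded.Build R 0 1 levy_limit levy_limitNy levy_limity).
by exists c => x; exact: levy_limit_cvg.
Qed.

End LevyLimit.

Lemma ordinal_countE (R : realType) (f : nat -> R) N x :
  #|[pred n : 'I_N | f n <= x]|%:R / N%:R = edf f N x :> R.
Proof.
rewrite /edf /avg -sum1_card big_mkord natr_sum big_mkcond /=; congr (_ / _).
by apply: eq_bigr => i _; rewrite inE; case: (f i <= x)%R.
Qed.

Lemma ler_edf (R : realType) (f : nat -> R) N x y : x <= y -> edf f N x <= edf f N y.
Proof.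
move=> xy; apply: ler_avg => m; rewrite ler_nat.
by case: (leP (f m) x) => // fx; rewrite (le_trans fx xy).
Qed.

Lemma edf01 (R : realType) (f : nat -> R) N x : 0 <= edf f N x <= 1.
Proof. by apply: avg01 => m; case: (f m <= x)%R; rewrite ?lexx ?ler01. Qed.

Lemma edf_tails (R : realType) (f : nat -> R) N : exists A : R,
  1 <= edf f N.+1 A /\ edf f N.+1 (- A) <= 0.
Proof.
(* The 1 makes the bound strict, so that no value is <= -A. *)
pose A : R := \sum_(0 <= m < N.+1) `|f m| + 1.
have fA m : (m <= N)%N -> `|f m| < A.
  move=> mN; rewrite /A (bigD1_seq m) ?iota_uniq ?mem_index_iota //=.
  by rewrite -addrA ltrDl ltr_wpDl // sumr_ge0.
exists A; rewrite /edf /avg; split.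
  suff -> : \sum_(0 <= m < N.+1) (f m <= A)%R%:R = N.+1%:R :> R by rewrite divff.
  rewrite -[RHS]mulr1 -sum_const_nat0.
  by apply: eq_big_nat => m /andP[_ /fA]; rewrite ltr_norml => /andP[_ /ltW ->].
rewrite big_nat big1 ?mul0r // => m /andP[_ /fA].
by rewrite ltr_norml => /andP[h _]; rewrite leNgt h.
Qed.

(** * Weak convergence and integrals *)

Section HellyBray.
Context (R : realType).

(** Steps are taken along closed left half-lines, whose masses are the values of the distribution
    function. *)
Definition simple_fun (c0 : R) (s : seq (R * R)) (y : R) : R :=
  c0 + \sum_(p <- s) p.1 * (y <= p.2)%R%:R.

Definition simple_int (E : R -> R) (c0 : R) (s : seq (R * R)) : R :=
  c0 + \sum_(p <- s) p.1 * E p.2.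

(* [v] is a possible value of the integral of [phi] against [dE]: it respects
   every bound of [phi] by a step function. *)
Definition Stieltjes_value (E phi : R -> R) (v : R) := forall c0 s,
  ((forall y, phi y <= simple_fun c0 s y) -> v <= simple_int E c0 s) /\
  ((forall y, simple_fun c0 s y <= phi y) -> simple_int E c0 s <= v).

Definition step_sum (phi : R -> R) (x : nat -> R) r (E : R -> R) : R :=
  \sum_(0 <= i < r) phi (x i) * (E (x i.+1) - E (x i)).

(** With the distribution function of the point mass at y, [step_sum] is the value at y of a step
    function. The indicators on the right add 1 exactly when y is outside ]x_0, x_r], where only
    |phi| <= 1 is available. *)
Lemma step_approx (phi : R -> R) (x : nat -> R) (e : R) r y : 0 <= e ->
    (forall z, `|phi z| <= 1) ->
    (forall i, x i <= x i.+1) ->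
    (forall i z, x i <= z <= x i.+1 -> `|phi z - phi (x i)| <= e) ->
  `|phi y - step_sum phi x r (fun u => (y <= u)%R%:R)| <=
    e + (y <= x 0%N)%R%:R + 1 - (y <= x r)%R%:R.
Proof.
move=> e0 phi1 xS osc.
have xm i j : (i <= j)%N -> x i <= x j.
  by move=> /subnK <-; elim: (j - i)%N => [//|k IH]; exact: le_trans IH (xS _).
have [yx|xy] := leP y (x 0%N).
  have yxi i : (y <= x i)%R by apply: le_trans yx _; exact: xm.
  rewrite /step_sum big1 ?subr0 ?yxi; last by move=> i _; rewrite !yxi subrr mulr0.
  by have := phi1 y; lra.
have H : if y <= x r then `|phi y - step_sum phi x r (fun u => (y <= u)%R%:R)| <= e : Prop
         else step_sum phi x r (fun u => (y <= u)%R%:R) = 0.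
  elim: r => [|r IH]; first by rewrite leNgt xy /= /step_sum big_geq.
  rewrite /step_sum big_nat_recr //= -/(step_sum phi x r (fun u => (y <= u)%R%:R)).
  case: (leP y (x r)) IH => [yr IH|ry ->].
    by rewrite (le_trans yr (xS r)) subrr mulr0 addr0.
  case: leP => yr1; last by rewrite subrr mulr0 addr0.
  by rewrite subr0 mulr1 add0r osc // yr1 ltW.
case: (y <= x r) H => [h|->]; first by rewrite addr0 addrK.
by rewrite !subr0 addr0; apply: le_trans (phi1 y) _; rewrite lerDr.
Qed.

(** The error bound of [step_approx] is itself a step function, so adding it to or subtracting it
    from the approximation gives admissible majorants and minorants. *)
Lemma Stieltjes_value_approx (E phi : R -> R) (v : R) (x : nat -> R) (e : R) r :
    0 <= e -> Stieltjes_value E phi v ->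
    (forall z, `|phi z| <= 1) ->
    (forall i, x i <= x i.+1) ->
    (forall i z, x i <= z <= x i.+1 -> `|phi z - phi (x i)| <= e) ->
  `|v - step_sum phi x r E| <= e + E (x 0%N) + 1 - E (x r).
Proof.
move=> e0 Ev phi1 xS osc.
pose st : seq (R * R) :=
  flatten [seq [:: (phi (x i), x i.+1); (- phi (x i), x i)] | i <- index_iota 0 r].
have stE (H : R -> R) : \sum_(p <- st) p.1 * H p.2 = step_sum phi x r H.
  rewrite big_flatten big_map /step_sum; apply: eq_bigr => i _.
  by rewrite !big_cons big_nil /= addr0 mulrBr mulNr.
have A y := @step_approx phi x e r y e0 phi1 xS osc.
have [up _] := Ev (e + 1) [:: (1, x 0%N), (-1, x r) & st].
have [_ lo] := Ev (- (e + 1)) [:: (-1, x 0%N), (1, x r) & st].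
rewrite ler_norml; apply/andP; split.
  have : simple_int E (- (e + 1)) [:: (-1, x 0%N), (1, x r) & st] <= v.
    apply: lo => y; rewrite /simple_fun !big_cons /= (stE (fun u => (y <= u)%R%:R)).
    by have := A y; rewrite ler_norml; lra.
  by rewrite /simple_int !big_cons /= stE; lra.
have : v <= simple_int E (e + 1) [:: (1, x 0%N), (-1, x r) & st].
  apply: up => y; rewrite /simple_fun !big_cons /= (stE (fun u => (y <= u)%R%:R)).
  by have := A y; rewrite ler_norml; lra.
by rewrite /simple_int !big_cons /= stE; lra.
Qed.

Lemma Stieltjes_value_edf (f : nat -> R) (phi : R -> R) N :
  Stieltjes_value (edf f N.+1) phi (avg (phi \o f) N.+1).
Proof.
have sE c0 s : avg (fun m => simple_fun c0 s (f m)) N.+1 = simple_int (edf f N.+1) c0 s.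
  rewrite /simple_fun avgD; congr (_ + _).
    by rewrite /avg sum_const_nat0 mulrC mulKf.
  rewrite /avg exchange_big /= mulr_suml; apply: eq_bigr => p _.
  by rewrite -mulr_sumr mulrA.
by move=> c0 s; split=> h; rewrite -sE; apply: ler_avg => m; exact: h.
Qed.

Lemma continuity_point_dense (F : cumulativeBounded (0 : R) (1 : R)) (u v : R) :
  u < v -> exists2 x, u < x < v & {for x, continuous F}.
Proof.
move=> uv.
have Fnd : {in `[u, v] &, nondecreasing_fun F}.
  by move=> x y _ _; exact: cumulative_is_nondecreasing.
have [x xuv xd] : exists2 x, u < x < v & ~ discontinuity F x.
  apply: contrapT => H.
  (* Otherwise the interval, of positive measure, would lie in the countable set of jumps. *)
  have sub : `]u, v[%classic `<=` [set x | x \in (`]u, v[) /\ discontinuity F x].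
    move=> x /= xuv; split=> //; apply: contrapT => xd; apply: H; exists x => //.
  have /countable_lebesgue_measure0 := sub_countable (subset_card_le sub)
    (discontinuity_countable Fnd).
  rewrite lebesgue_measure_itv /= lte_fin uv -EFinB => -[]; lra.
exists x => //; case/andP: xuv => ux xv.
have Fr : F y @[y --> x^'+] --> F x by exact: cumulative_is_right_continuous.
have Fl : cvg (F y @[y --> x^'-]).
  apply: nondecreasing_at_left_is_cvgr.
    by near=> w => y z _ _; exact: cumulative_is_nondecreasing.
  near=> w; exists (F x) => _ /= [y /[!in_itv] /= /andP[_ yx] <-].
  by apply: cumulative_is_nondecreasing; exact: ltW.
apply/left_right_continuousP; split => //.
suff <- : lim (F y @[y --> x^'-]) = F x by [].
apply: contrapT => /eqP ne; apply: xd; split=> //; first by apply/cvg_ex; exists (F x).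
by rewrite (cvg_lim _ Fr).
Unshelve. all: by end_near. Qed.

(** On a finite mesh of continuity points of [F] the step sums converge, and
    [Stieltjes_value_approx] compares them with both the averages and v. *)
Lemma Helly_Bray (f : nat -> R) (F : cumulativeBounded (0 : R) (1 : R))
    (phi : R -> R) (L v : R) : 0 <= L ->
    (forall x, {for x, continuous F} -> (fun N => edf f N x) @ \oo --> F x) ->
    (forall z, `|phi z| <= 1) -> (forall y z, `|phi y - phi z| <= L * `|y - z|) ->
    Stieltjes_value F phi v ->
  (fun N => avg (phi \o f) N) @ \oo --> v.
Proof.
move=> L0 Fcv phi1 phiL Fv; apply/cvgrPdist_le => e e0.
pose L1 := L + 1; have L10 : 0 < L1 by rewrite ltr_wpDl.
have e16 : 0 < e / 16 by rewrite divr_gt0.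
have [A0 [_ hA0]] : \forall x \near -oo, F x <= e / 16.
  have /cvgrPdist_le/(_ _ e16) := cumulativeNy F.
  by apply: filterS => x; rewrite ler_norml; lra.
have [A1 [_ hA1]] : \forall x \near +oo, 1 - F x <= e / 16.
  have /cvgrPdist_le/(_ _ e16) := cumulativey F.
  by apply: filterS => x; rewrite ler_norml; lra.
pose d := e / 32 / L1; have d0 : 0 < d by rewrite !divr_gt0.
(* Adjacent disjoint intervals of length d: the points increase, the mesh is at most 2 d, and x_0 <
   A0. *)
have /choice[x xP] i : exists x, (A0 - d + i%:R * d - d < x < A0 - d + i%:R * d) /\
    {for x, continuous F}.
  have [|x h1 h2] := @continuity_point_dense F (A0 - d + i%:R * d - d) (A0 - d + i%:R * d).
    by lra.
  by exists x.
have xb i : A0 - d + i%:R * d - d < x i < A0 - d + i%:R * d by case: (xP i).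
have xS i : x i <= x i.+1.
  by have := xb i; have := xb i.+1; rewrite -natr1; lra.
have mesh i : x i.+1 - x i <= 2 * d.
  by have := xb i; have := xb i.+1; rewrite -natr1; lra.
have osc i z : x i <= z <= x i.+1 -> `|phi z - phi (x i)| <= e / 16.
  move=> /andP[xz zx]; apply: le_trans (phiL _ _) _.
  apply: (@le_trans _ _ (L1 * (2 * d))).
    apply: ler_pM => //; first by rewrite /L1; lra.
    by rewrite ger0_norm ?subr_ge0 //; have := mesh i; lra.
  by rewrite /d mulrCA [L1 * _]mulrC divfK ?gt_eqF //; lra.
have [r hr] : exists r, A1 < x r.
  exists (Num.bound `|(A1 - A0) / d + 2|); set r := Num.bound _.
  have : (A1 - A0) / d + 2 < r%:R.
    by apply: le_lt_trans (ler_norm _) _; exact: archi_boundP.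
  rewrite -(ltr_pM2r d0) mulrDl divfK ?gt_eqF //.
  by have := xb r; lra.
have tail0 : F (x 0%N) <= e / 16 by apply: hA0; have := xb 0%N; rewrite mul0r; lra.
have tail1 : 1 - F (x r) <= e / 16 by exact: hA1.
have apF := @Stieltjes_value_approx F phi v x (e / 16) r (ltW e16) Fv phi1 xS osc.
have c0 := Fcv _ (xP 0%N).2; have cr := Fcv _ (xP r).2.
have cS : (fun N => step_sum phi x r (edf f N)) @ \oo --> step_sum phi x r F.
  apply: cvg_big => [|i _]; first exact: add_continuous.
  by apply: cvgM; [exact: cvg_cst | apply: cvgB; exact: (Fcv _ (xP _).2)].
near=> N.
have N0 : (0 < N)%N by near: N; exact: nbhs_infty_gt.
have h0 : `|F (x 0%N) - edf f N (x 0%N)| <= e / 16.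
  by near: N; move/cvgrPdist_le: c0; exact.
have h1 : `|F (x r) - edf f N (x r)| <= e / 16.
  by near: N; move/cvgrPdist_le: cr; exact.
have h2 : `|step_sum phi x r F - step_sum phi x r (edf f N)| <= e / 16.
  by near: N; move/cvgrPdist_le: cS; exact.
have apN : `|avg (phi \o f) N - step_sum phi x r (edf f N)| <=
    e / 16 + edf f N (x 0%N) + 1 - edf f N (x r).
  case: (N) N0 => // n _.
  apply: Stieltjes_value_approx => //; [exact: ltW | exact: Stieltjes_value_edf].
(* In sixteenths of e: 3 for v, 5 for the average, 1 between the two step sums. *)
move: apF apN h0 h1 h2; rewrite !ler_norml; lra.
Unshelve. all: by end_near. Qed.

End HellyBray.

(** * Integration against the Lebesgue-Stieltjes measure *)

Section StieltjesIntegral.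
Context (R : realType) (F : cumulativeBounded (0 : R) (1 : R)).
Local Open Scope measure_display_scope.
Let mu := lebesgue_stieltjes_measure F.

Let idTR : measurableTypeR R -> R := idfun.

#[local] HB.instance Definition _ :=
  @isMeasurableFun.Build _ _ _ _ idTR (@measurable_id _ _ setT).

Lemma Stieltjes_measure_ray r : mu `]-oo, r]%classic = (F r)%:E.
Proof. by rewrite -cdf_lebesgue_stieltjes_id. Qed.

Lemma Stieltjes_measure_setT : mu setT = 1%E.
Proof. exact: (@probability_setT _ _ _ (lebesgue_stieltjes_measure F)). Qed.

Lemma Stieltjes_integrable (phi : measurableTypeR R -> R) (M : R) :
  measurable_fun setT phi -> (forall x, `|phi x| <= M) ->
  mu.-integrable setT (EFin \o phi).
Proof.
move=> mphi phiM; apply: measurable_bounded_integrable => //.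
  exact: (eq_ind_r (fun z => (z < +oo)%E) (ltry 1) Stieltjes_measure_setT).
exists M; split; first exact: num_real.
by move=> y My x _ /=; apply: le_trans (phiM x) _; exact: ltW.
Qed.

Lemma ray_indicE (r : R) : (fun y => (y <= r)%R%:R) = \1_(`]-oo, r]%classic : set R) :> (R -> R).
Proof. by apply/funext => y; rewrite indicE mem_setE in_itv. Qed.

Lemma simple_fun_integral c0 s :
  mu.-integrable setT (EFin \o (simple_fun c0 s : measurableTypeR R -> R)) /\
  \int[mu]_x simple_fun c0 s x = simple_int F c0 s.
Proof.
elim: s => [|[c x] s [IHi IH]].
  have -> : simple_fun c0 [::] = fun=> c0.
    by apply/funext => y; rewrite /simple_fun big_nil addr0.
  split.
    by apply: (@Stieltjes_integrable _ `|c0|) => //; exact: measurable_cst.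
  rewrite Rintegral_cst // (_ : fine _ = 1); last exact: (congr1 fine Stieltjes_measure_setT).
  by rewrite /simple_int big_nil addr0 mulr1.
have E : simple_fun c0 ((c, x) :: s) =
  (fun y => c * (\1_(`]-oo, x]%classic : set R) y : R) + simple_fun c0 s y).
  apply/funext => y; rewrite -ray_indicE /simple_fun big_cons /=; ring.
have mi : measurable (`]-oo, x]%classic : set (measurableTypeR R)) by [].
have ii : mu.-integrable setT (EFin \o (\1_(`]-oo, x]%classic : set (measurableTypeR R)))).
  exact: integrable_indic.
have ic : mu.-integrable setT (EFin \o
    (fun y : measurableTypeR R => c * \1_(`]-oo, x]%classic : set (measurableTypeR R)) y)).
  by apply: (@eq_integrable _ _ _ mu setT measurableT _ _ _ (integrableZl measurableT c ii)).
rewrite E; split.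
  by apply: (@eq_integrable _ _ _ mu setT measurableT _ _ _ (integrableD measurableT ic IHi)).
rewrite RintegralD // IH RintegralZl // /simple_int big_cons /=.
have -> : \int[mu]_y (\1_(`]-oo, x]%classic : set (measurableTypeR R)) y) = F x.
  by rewrite /Rintegral integral_indic // setIT; exact: (congr1 fine (Stieltjes_measure_ray x)).
ring.
Qed.

Lemma Stieltjes_value_Rintegral (phi : measurableTypeR R -> R) (M : R) :
  measurable_fun setT phi -> (forall x, `|phi x| <= M) ->
  Stieltjes_value F phi (\int[mu]_x phi x).
Proof.
move=> mphi phiM c0 s; have [si <-] := simple_fun_integral c0 s.
have pI := Stieltjes_integrable mphi phiM.
by split=> h; apply: le_Rintegral.
Qed.

End StieltjesIntegral.

(** * The matrix product *)

Section Complex.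
Context (R : realType).

Lemma complex_cvg (u v : nat -> R) (x y : R) : u @ \oo --> x -> v @ \oo --> y ->
  (fun n => (u n +i* v n : Cplx R)) @ \oo --> (x +i* y : Cplx R).
Proof.
move=> ux vy; apply/cvgrPdist_lt => e; rewrite ltcE /= => /andP[/eqP e0 er].
have e2 : 0 < complex.Re e / 2 by rewrite divr_gt0.
move/cvgrPdist_lt/(_ _ e2): ux => ux; move/cvgrPdist_lt/(_ _ e2): vy => vy.
near=> n.
have un : `|x - u n| < complex.Re e / 2 by near: n.
have vn : `|y - v n| < complex.Re e / 2 by near: n.
rewrite normc_def ltcE /= e0 eqxx /=.
have le : Num.sqrt ((x - u n) ^+ 2 + (y - v n) ^+ 2) <= `|x - u n| + `|y - v n|.
  move: (x - u n) (y - v n) => p q.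
  rewrite -ler_sqr ?nnegrE ?sqrtr_ge0 ?addr_ge0 // sqr_sqrtr ?addr_ge0 ?sqr_ge0 //.
  rewrite sqrrD !(real_normK (num_real _)).
  by have := mulr_ge0 (normr_ge0 p) (normr_ge0 q); lra.
apply: le_lt_trans le _; lra.
Unshelve. all: by end_near. Qed.

Lemma expiD (x y : R) : expi (x + y) = expi x * expi y.
Proof.
rewrite /expi sinD cosD; apply/eqP; rewrite eq_complex /=.
by apply/andP; split; apply/eqP; ring.
Qed.

Lemma expi0 : expi (0 : R) = 1.
Proof. by rewrite /expi cos0 sin0. Qed.

Lemma sum_expi (g : nat -> R) N : \sum_(0 <= m < N) expi (g m) =
  (\sum_(0 <= m < N) cos (g m)) +i* (\sum_(0 <= m < N) sin (g m)) :> Cplx R.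
Proof.
elim: N => [|N IH]; first by rewrite !big_geq.
by rewrite !big_nat_recr //= IH.
Qed.

End Complex.

(** Turning sums into products, [e] factors every block of [greedy_sum_split]. *)
Lemma greedy_sum_mul (V : nmodType) (K : comPzRingType) (a b : nat)
    (hab : (1 <= b <= a)%N) (f : nat -> V) (e : V -> K) n :
    greedy_additive a b f -> (forall x y, e (x + y) = e x * e y) ->
  \sum_(0 <= m < Gseq a b n.+2) e (f m) =
    (\sum_(0 <= k < a) e (f (k * Gseq a b n.+1)%N)) *
      \sum_(0 <= m < Gseq a b n.+1) e (f m) +
    e (f (a * Gseq a b n.+1)%N) * (\sum_(0 <= k < b) e (f (k * Gseq a b n)%N)) *
      \sum_(0 <= m < Gseq a b n) e (f m).
Proof.
move=> hf eD; rewrite (greedy_sum_split hab e n hf); congr (_ + _).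
  rewrite mulr_suml; apply: eq_bigr => k _; rewrite mulr_sumr.
  by apply: eq_bigr => m _; rewrite eD.
rewrite [X in X * _]mulr_sumr mulr_suml; apply: eq_bigr => k _; rewrite mulr_sumr.
by apply: eq_bigr => m _; rewrite !eD.
Qed.

(** * The matrix product as an exponential sum, and its limit *)

Section PhiSeq.
Context (R : realType) (a b : nat) (hab : (1 <= b <= a)%N) (f : nat -> R).
Context (hf : greedy_additive a b f).
Local Notation G := (Gseq a b).
Local Notation H := (Hsum a b f).

Lemma HsumE n t : H n t = \sum_(0 <= m < G n) expi (t * f m).
Proof. by rewrite big_mkord. Qed.

Lemma sigmaE c n t :
  sigma a b f c n t = \sum_(0 <= k < c) expi (t * f (k * G n)%N).
Proof. by rewrite big_mkord. Qed.

Lemma Hsum0 t : H 0 t = 1.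
Proof. by rewrite HsumE big_nat1 hf.1 mulr0 expi0. Qed.

Lemma Hsum_rec n t : H n.+2 t = sigma a b f a n.+1 t * H n.+1 t
  + expi (t * f (a * G n.+1)%N) * sigma a b f b n t * H n t.
Proof.
rewrite !HsumE !sigmaE.
have eD (x y : R) : expi (t * (x + y)) = expi (t * x) * expi (t * y).
  by rewrite mulrDr expiD.
exact: (greedy_sum_mul (K := Cplx R) hab n hf eD).
Qed.

Lemma Amx_prod_colH1 n t : Amx_prod a b f n.+1 t *m colH1 a b f t =
  \col_(i < 2) [:: H n.+1 t; H n t]`_i.
Proof.
elim: n => [|n IH].
  by rewrite /Amx_prod big_geq // mul1mx /colH1 Hsum0.
(* The indices decrease, so the factor k = 1 is the newest matrix, on the left. *)
have -> : Amx_prod a b f n.+2 t = Amx a b f n.+1 t *m Amx_prod a b f n.+1 t.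
  by rewrite /Amx_prod big_ltn // subn1 big_add1.
rewrite -mulmxA IH; apply/colP => i; rewrite !mxE big_ord_recl big_ord1 !mxE.
case: i => [[|[|//]] Hi] /=.
  by rewrite Hsum_rec.
by rewrite mul1r mul0r addr0.
Qed.

(** At n = 0 the empty product would give H_1 instead of H_0. *)
Lemma Phi_seqE n t : (0 < n)%N -> Phi_seq a b f t n = ((alpha R a b) ^- n)%:C * H n t.
Proof.
case: n => // n _; rewrite /Phi_seq -mulmxA Amx_prod_colH1; congr (_ * _).
by rewrite !mxE big_ord_recl big_ord1 !mxE /= mul1r mul0r addr0.
Qed.

Lemma Phi_seq_avg n t : (0 < n)%N -> Phi_seq a b f t n =
  ((G n)%:R / alpha R a b ^+ n * avg (fun m => cos (t * f m)) (G n)) +i*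
  ((G n)%:R / alpha R a b ^+ n * avg (fun m => sin (t * f m)) (G n)).
Proof.
move=> n0; rewrite Phi_seqE // HsumE sum_expi /avg.
have g0 : (G n)%:R != 0 :> R by rewrite gt_eqF // Gseq_gt0R.
have E (s : R) : (G n)%:R / alpha R a b ^+ n * (s / (G n)%:R) = alpha R a b ^- n * s.
  by rewrite mulrAC mulrCA divff // mulr1 mulrC.
rewrite !E; apply/eqP; rewrite eq_complex /=.
by rewrite !mul0r subr0 addr0 !eqxx.
Qed.

Lemma Gseq_cvg_infty : G @ \oo --> \oo.
Proof.
move=> A [N _ hN]; exists N => // n /= Nn; apply: hN => /=.
exact: leq_trans Nn (ltnW (ltn_Gseq hab n)).
Qed.

Lemma trig_Lipschitz (h dh : R -> R) (t y z : R) :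
  (forall x : R, is_derive x (1 : R) h (dh x)) -> (forall x, `|dh x| <= 1) ->
  `|h (t * y) - h (t * z)| <= `|t| * `|y - z|.
Proof.
move=> hd dh1; have hc : continuous h.
  move=> x; apply/differentiable_continuous/derivable1_diffP.
  exact: (@ex_derive _ _ _ _ _ _ _ (hd x)).
rewrite -normrM mulrBr; move: (t * y) (t * z) => {y z} y z.
wlog yz : y z / y <= z.
  by move=> W; have [/W//|/ltW/W] := leP y z; rewrite distrC [leRHS]distrC.
have [c _ e] := MVT_segment yz (fun x _ => hd x) (continuous_subspaceT hc).
by rewrite distrC e normrM [leRHS]distrC ler_piMl.
Qed.

Lemma avg_trig_cvg (F : cumulativeBounded (0 : R) (1 : R)) (h dh : R -> R) t :
  (forall x, {for x, continuous F} -> (fun N => edf f N x) @ \oo --> F x) ->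
  (forall x : R, is_derive x (1 : R) h (dh x)) -> (forall x, `|dh x| <= 1) ->
  (forall x, `|h x| <= 1) ->
  (fun N => avg (fun m => h (t * f m)) N) @ \oo -->
    \int[lebesgue_stieltjes_measure F]_x h (t * x).
Proof.
move=> Fc hd dh1 h1.
have lip y z := @trig_Lipschitz h dh t y z hd dh1.
apply: (@Helly_Bray R f F (fun x => h (t * x)) `|t|) => //.
apply: (@Stieltjes_value_Rintegral R F (fun x => h (t * x)) 1) => //.
apply: continuous_measurable_fun => x.
have hc : continuous h.
  move=> y; apply/differentiable_continuous/derivable1_diffP.
  exact: (@ex_derive _ _ _ _ _ _ _ (hd y)).
apply: (continuous_comp (f := fun x => t * x)); last exact: hc.
by apply: cvgM; [exact: cvg_cst | exact: cvg_id].
Qed.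

End PhiSeq.

Theorem mainTheorem2 (R : realType) (a b : nat) (hab : (1 <= b <= a)%N)
    (f : nat -> R) (hf : G_additive a b f)
    (hD : cvgn (fun N : nat => \sum_(1 <= n < N) Dterm a b f n : R))
    (hf2 : cvgn (fun N : nat =>
       \sum_(0 <= n < N) \sum_(1 <= k < a.+1) f (k * Gseq a b n)%N ^+ 2 : R)) :
  (exists F : cumulativeBounded (0 : R) (1 : R),
     is_limiting_distribution f F) /\
  (forall F : cumulativeBounded (0 : R) (1 : R),
     is_limiting_distribution f F ->
     forall t : R,
       cvgn (Phi_seq a b f t) /\
       char_fun F t = ((kappa R a b)^-1)%:C * limn (Phi_seq a b f t)).
Proof.
have hg := G_additive_greedy hab hf; split.
  have [F hF] := @levy_cauchy_limit R (edf f) (ler_edf f) (edf01 f) (edf_tails f)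
    (edf_levy_cauchy hab hg hD hf2).
  by exists F => x xF; under eq_cvg do rewrite ordinal_countE; exact: hF.
move=> F hF t.
have Fc x : {for x, continuous F} -> (fun N => edf f N x) @ \oo --> F x.
  by move=> xF; under eq_cvg do rewrite -ordinal_countE; exact: hF.
(* By [Phi_seq_avg] each part is G_n / alpha^n, tending to kappa, times an average along the
   subsequence G_n. *)
have lim : Phi_seq a b f t @ \oo --> ((kappa R a b)%:C * char_fun F t : Cplx R).
  have k c : (fun N => avg (fun m => c (t * f m)) N) @ \oo -->
      \int[lebesgue_stieltjes_measure F]_x c (t * x) ->
    (fun n => (Gseq a b n)%:R / alpha R a b ^+ n *
       avg (fun m => c (t * f m)) (Gseq a b n)) @ \oo -->
      kappa R a b * \int[lebesgue_stieltjes_measure F]_x c (t * x).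
    move=> cc; apply: cvgM; first exact: Gseq_alpha_cvg.
    exact: (cvg_comp _ _ (Gseq_cvg_infty hab) cc).
  have sinN x : `|- sin x| <= 1 :> R by rewrite normrN; exact: sin_max.
  have kc := k _ (avg_trig_cvg Fc (@is_derive_cos R) sinN (@cos_max R)).
  have ks := k _ (avg_trig_cvg Fc (@is_derive_sin R) (@cos_max R) (@sin_max R)).
  have -> : (kappa R a b)%:C * char_fun F t =
     (kappa R a b * \int[lebesgue_stieltjes_measure F]_x cos (t * x)) +i*
     (kappa R a b * \int[lebesgue_stieltjes_measure F]_x sin (t * x)) :> Cplx R.
    by apply/eqP; rewrite eq_complex /= !mul0r subr0 addr0 !eqxx.
  have := complex_cvg kc ks.
  apply: cvg_trans; apply: near_eq_cvg; near=> n.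
  by rewrite Phi_seq_avg //; near: n; exact: nbhs_infty_gt.
split; first by apply/cvg_ex; exists ((kappa R a b)%:C * char_fun F t).
rewrite (cvg_lim (@norm_hausdorff _ _) lim) mulrA -rmorphM mulVf ?mul1r //.
by rewrite gt_eqF // kappa_gt0.
Unshelve. all: by end_near. Qed.
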